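(* Let $K$ be a field of characteristic different from $2$ and let $X$ be a connected poset such that every multiplicative automorphism of $FI(X,K)$ is inner and every derivation from $FI(X,K)$ to $I(X,K)$ is inner. The involutions $\Phi_1$ and $\Phi_2$ on $D(X,K)$ are equivalent if and only if there exist an automorphism $\alpha$ of $X$ and $k\in K^*$ such that the involutions $\Phi_1$ and $\widetilde{\alpha}\circ\widetilde{k\delta}\circ\Phi_2\circ\widetilde{k^{-1}\delta}\circ\widetilde{\alpha^{-1}}$ are equivalent via inner automorphism.
   Context: For a field $K$ and a poset $X$, the incidence space $I(X,K)$ is the $K$-space of functions $f:X\times X\to K$ with $f(x,y)=0$ whenever $x\nleq y$. The finitary incidence algebra $FI(X,K)$ is the subspace of all $f\in I(X,K)$ such that for all $x\le y$ in $X$ there are only finitely many subintervals $[u,v]\subseteq[x,y]$ with $u\ne v$ and $f(u,v)\neq 0$. It is an associative unital $K$-algebra, with unity $\delta$, under convolution $(fg)(x,y)=\sum_{x\le z\le y}f(x,z)g(z,y)$, and the same formula makes $I(X,K)$ an $FI(X,K)$-bimodule. $D(X,K)$ is the $K$-algebra $FI(X,K)\oplus I(X,K)$, elements written as columns, with multiplication $\begin{bmatrix}f\\ i\end{bmatrix}\begin{bmatrix}g\\ j\end{bmatrix}=\begin{bmatrix}fg\\ fj+ig\end{bmatrix}$. Inner automorphisms of an algebra are the maps $a\mapsto uau^{-1}$, $u$ a unit. An involution on a $K$-algebra is a $K$-linear anti-automorphism whose square is the identity. Involutions $\phi,\varphi$ on a $K$-algebra $A$ are equivalent if $\Psi\circ\phi=\varphi\circ\Psi$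 for some $K$-linear automorphism $\Psi$ of $A$, and equivalent via inner automorphism if $\Psi$ can be chosen inner. A poset is connected if any two elements are joined by a finite sequence in which consecutive elements are comparable. An automorphism of a poset is a bijection $\alpha$ with $x\le y\Leftrightarrow\alpha(x)\le\alpha(y)$. A multiplicative automorphism of $FI(X,K)$ is a map $M_\sigma(f)(x,y)=\sigma(x,y)f(x,y)$, where $\sigma\in I(X,K)$ satisfies $\sigma(x,y)\neq0$ for all $x\le y$ and $\sigma(x,y)\sigma(y,z)=\sigma(x,z)$ for $x\le y\le z$. A derivation $D:FI(X,K)\to I(X,K)$ is a $K$-linear map with $D(fg)=D(f)g+fD(g)$; it is inner if there is $i\in I(X,K)$ with $D(f)=fi-if$ for all $f$. For an automorphism $\alpha$ of $X$, $\widetilde\alpha$ is the automorphism of $D(X,K)$ given by $\widetilde\alpha\left(\begin{bmatrix}f\\ i\end{bmatrix}\right)=\begin{bmatrix}f'\\ i'\end{bmatrix}$ with $f'(x,y)=f(\alpha^{-1}(x),\alpha^{-1}(y))$ and $i'(x,y)=i(\alpha^{-1}(x),\alpha^{-1}(y))$. For $k\in K^*$, $\widetilde{k\delta}\left(\begin{bmatrix}f\\ i\end{bmatrix}\right)=\begin{bmatrix}f\\ ki\end{bmatrix}$. *)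

(* Defs.v *)
From HB Require Import structures.
From mathcomp Require Import all_boot all_order all_algebra.
From mathcomp Require Import mathcomp_extra boolp classical_sets functions.
From mathcomp Require Import cardinality fsbigop.

Set Implicit Arguments.
Unset Strict Implicit.
Unset Printing Implicit Defensive.

Import Order.TTheory GRing.Theory.
Local Open Scope classical_set_scope.
Local Open Scope ring_scope.

Definition inner_automorphism (A : pzRingType) (Psi : A -> A) : Prop :=
  exists u v : A, [/\ u * v = 1, v * u = 1 & forall a, Psi a = u * a * v].

Definition connected_poset d (X : porderType d) : Prop :=
  forall x y : X, exists s : seq X, path >=<%O x s /\ last x s = y.

Record poset_automorphism d (X : porderType d) := PosetAutomorphism {
  pa_fun :> X -> X;
  pa_inv : X -> X;
  pa_funK : cancel pa_fun pa_inv;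
  pa_invK : cancel pa_inv pa_fun;
  pa_mono : {mono pa_fun : x y / (x <= y)%O}
}.

Lemma pa_inv_mono d (X : porderType d) (a : poset_automorphism X) :
  {mono pa_inv a : x y / (x <= y)%O}.
Proof. by move=> x y; rewrite -(pa_mono a) !pa_invK. Qed.

Definition poset_automorphism_inverse d (X : porderType d)
    (a : poset_automorphism X) : poset_automorphism X :=
  PosetAutomorphism (pa_invK a) (pa_funK a) (pa_inv_mono a).

Section IncidenceSpace.
Variables (d : Order.disp_t) (X : porderType d) (K : fieldType).
Implicit Types (f g h : X -> X -> K) (x y z u v w : X).

Definition incidence_pred : {pred X -> X -> K} :=
  fun f => `[< forall x y, ~~ (x <= y)%O -> f x y = 0 >].

Lemma incidence_predP f :
  reflect (forall x y, ~~ (x <= y)%O -> f x y = 0) (f \in incidence_pred).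
Proof. exact: asboolP. Qed.

Lemma incidence_zmod_closed : zmod_closed incidence_pred.
Proof.
split; first exact/incidence_predP.
move=> f g /incidence_predP Hf /incidence_predP Hg; apply/incidence_predP.
move=> x y xy; have -> : (f - g) x y = f x y - g x y by [].
by rewrite Hf // Hg // subr0.
Qed.

HB.instance Definition _ :=
  GRing.isZmodClosed.Build (X -> X -> K) incidence_pred incidence_zmod_closed.

Record incidence : Type := Incidence {
  incidence_fun :> X -> X -> K;
  _ : incidence_fun \in incidence_pred
}.

HB.instance Definition _ := [isSub for incidence_fun].
HB.instance Definition _ := [Choice of incidence by <:].
HB.instance Definition _ := [SubChoice_isSubZmodule of incidence by <:].

Lemma incidence_eq0 (i : incidence) x y : ~~ (x <= y)%O -> i x y = 0.
Proof. exact/incidence_predP/(valP i). Qed.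

Lemma incidenceP (i j : incidence) : (forall x y, i x y = j x y) -> i = j.
Proof. by move=> ij; apply/val_inj/funext => x; apply/funext => y; apply: ij. Qed.

Lemma scale_incidence_subproof (k : K) (i : incidence) :
  (fun x y => k * i x y) \in incidence_pred.
Proof. by apply/incidence_predP => x y /(incidence_eq0 i) ->; rewrite mulr0. Qed.

Definition incidence_scale (k : K) (i : incidence) : incidence :=
  Incidence (scale_incidence_subproof k i).

Fact incidence_scaleA (a b : K) (i : incidence) :
  incidence_scale a (incidence_scale b i) = incidence_scale (a * b) i.
Proof. by apply: incidenceP => x y /=; rewrite mulrA. Qed.
Fact incidence_scale1 : left_id 1 incidence_scale.
Proof. by move=> i; apply: incidenceP => x y /=; rewrite mul1r. Qed.
Fact incidence_scaleDr : right_distributive incidence_scale +%R.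
Proof. by move=> k i j; apply: incidenceP => x y; exact: mulrDr. Qed.
Fact incidence_scaleDl (i : incidence) :
  {morph incidence_scale^~ i : a b / a + b}.
Proof. by move=> a b; apply: incidenceP => x y; exact: mulrDl. Qed.

HB.instance Definition _ := GRing.Zmodule_isLmodule.Build K incidence
  incidence_scaleA incidence_scale1 incidence_scaleDr incidence_scaleDl.

Lemma incidence_lin (k : K) (i j : incidence) x y :
  (k *: i + j) x y = k * i x y + j x y.
Proof. by []. Qed.

Definition nonzero_subintervals f x y : set (X * X) :=
  [set p | [/\ (x <= p.1)%O, (p.1 < p.2)%O, (p.2 <= y)%O & f p.1 p.2 != 0]].

Definition finitary_pred : {pred incidence} :=
  fun i => `[< forall x y, (x <= y)%O -> finite_set (nonzero_subintervals i x y) >].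

Lemma finitary_predP (i : incidence) :
  reflect (forall x y, (x <= y)%O -> finite_set (nonzero_subintervals i x y))
    (i \in finitary_pred).
Proof. exact: asboolP. Qed.

Lemma finitary_submod_closed : submod_closed finitary_pred.
Proof.
split.
  apply/finitary_predP => x y _; rewrite (_ : nonzero_subintervals _ _ _ = set0) //.
  by apply/seteqP; split => // p [_ _ _]; rewrite eqxx.
move=> k f g /finitary_predP Hf /finitary_predP Hg; apply/finitary_predP => x y xy.
have := Hf _ _ xy; have := Hg _ _ xy => Fg Ff.
apply: (@sub_finite_set _ _
  (nonzero_subintervals f x y `|` nonzero_subintervals g x y)); last first.
  by rewrite finite_setU.
move=> p [xp pp py]; rewrite incidence_lin => nz.
case: (eqVneq (f p.1 p.2) 0) => [f0|fn0]; last by left.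
by right; split => //; apply: contra nz => /eqP ->; rewrite f0 mulr0 addr0.
Qed.

HB.instance Definition _ :=
  GRing.isSubmodClosed.Build K incidence finitary_pred finitary_submod_closed.

Record finitary : Type := Finitary {
  finitary_incidence :> incidence;
  _ : finitary_incidence \in finitary_pred
}.

HB.instance Definition _ := [isSub for finitary_incidence].
HB.instance Definition _ := [Choice of finitary by <:].
HB.instance Definition _ := [SubChoice_isSubLmodule of finitary by <:].

Lemma finitary_finite (f : finitary) x y :
  (x <= y)%O -> finite_set (nonzero_subintervals f x y).
Proof. exact/finitary_predP/(valP f). Qed.

Lemma finitaryP (f g : finitary) : (forall x y, f x y = g x y) -> f = g.
Proof. by move=> fg; apply/val_inj/incidenceP. Qed.

(* The sum is over a possibly infinite interval; \sum_(z \in A) is the sum of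
   the nonzero terms when there are finitely many of them (see
   convolution_finite below for the case used here), and 0 otherwise. *)
Definition convolution f g x y : K :=
  \sum_(z \in [set z | (x <= z)%O /\ (z <= y)%O]) f x z * g z y.

Lemma convolution_incidence f g : convolution f g \in incidence_pred.
Proof.
apply/incidence_predP => x y xy; rewrite /convolution fsbig1 // => z [xz zy].
by rewrite (le_trans xz zy) in xy.
Qed.

Definition conv (i j : incidence) : incidence :=
  Incidence (convolution_incidence i j).

(* [controls S f x y]: S contains the endpoints of the proper subintervals of
   [x, y] on which f does not vanish. *)
Definition controls (S : seq X) (f : incidence) x y : Prop :=
  forall u v, (x <= u)%O -> (v <= y)%O -> u != v -> f u v != 0 ->
    (u \in S) && (v \in S).

Lemma controls_exists (f g : finitary) x y :
  exists S : seq X, [/\ uniq S, x \in S, y \in S, controls S f x y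
    & controls S g x y].
Proof.
have [xy|xy] := boolP (x <= y)%O; last first.
  exists (undup [:: x; y]).
  have H (h : incidence) : controls (undup [:: x; y]) h x y.
    move=> u v xu vy _ nz; case: (boolP (u <= v)%O) => uv.
      by rewrite (le_trans xu (le_trans uv vy)) in xy.
    by rewrite incidence_eq0 ?eqxx in nz.
  by split; rewrite ?undup_uniq ?mem_undup ?inE ?eqxx ?orbT.
have /finite_seqP[Sf Ef] := finitary_finite f xy.
have /finite_seqP[Sg Eg] := finitary_finite g xy.
pose S := undup ([:: x; y] ++ (map fst Sf ++ map snd Sf)
                           ++ (map fst Sg ++ map snd Sg)).
have H (h : incidence) T : nonzero_subintervals h x y = [set` T] ->
    {subset map fst T ++ map snd T <= S} -> controls S h x y.
  move=> E sub u v xu vy uv nz.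
  have uvl : (u <= v)%O by apply: contraNT nz => ?; rewrite incidence_eq0.
  have /= pT : [set` T] (u, v) by rewrite -E; split; rewrite //= lt_neqAle uv.
  by apply/andP; split; apply: sub; rewrite mem_cat;
    [rewrite (map_f fst pT)|rewrite (map_f snd pT) orbT].
exists S; split; rewrite ?undup_uniq ?mem_undup ?inE ?eqxx ?orbT //.
- by apply: (H f Sf) => // z zT; rewrite mem_undup !mem_cat -(mem_cat z (map _ _)) zT orbT.
- by apply: (H g Sg) => // z zT; rewrite mem_undup !mem_cat -!(mem_cat z (map _ _)) zT !orbT.
Qed.

Lemma convolution_seq (i j : incidence) (S : seq X) x y : uniq S ->
  (forall z, (x <= z)%O -> (z <= y)%O -> i x z * j z y != 0 -> z \in S) ->
  conv i j x y = \sum_(z <- S) i x z * j z y.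
Proof.
move=> uS HS; rewrite /= /convolution fsbig_supp; apply: fsbig_fwiden => //.
  by move=> z [[xz zy]] /= /eqP nz; apply: HS.
move=> z [_ nz] /=; apply: contrapT => nz'; apply: nz; split => //.
split; apply: contrapT => /negP.
  by move/(incidence_eq0 i) => z0; apply: nz'; rewrite z0 mul0r.
by move/(incidence_eq0 j) => z0; apply: nz'; rewrite z0 mulr0.
Qed.

Lemma convolution_seql (i j : incidence) (S : seq X) a b x y : uniq S ->
  (a <= x)%O -> (y <= b)%O -> controls S i a b -> x \in S ->
  conv i j x y = \sum_(z <- S) i x z * j z y.
Proof.
move=> uS ax yb cS xS; apply: convolution_seq => // z xz zy.
rewrite mulf_eq0 negb_or => /andP[nz _]; have [<- //|xz'] := eqVneq x z.
by have /andP[] := cS x z ax (le_trans zy yb) xz' nz.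
Qed.

Lemma convolution_seqr (i j : incidence) (S : seq X) a b x y : uniq S ->
  (a <= x)%O -> (y <= b)%O -> controls S j a b -> y \in S ->
  conv i j x y = \sum_(z <- S) i x z * j z y.
Proof.
move=> uS ax yb cS yS; apply: convolution_seq => // z xz zy.
rewrite mulf_eq0 negb_or => /andP[_ nz]; have [-> //|zy'] := eqVneq z y.
by have /andP[] := cS z y (le_trans ax xz) yb zy' nz.
Qed.

Lemma convolution_neq0 (i j : incidence) x y : conv i j x y != 0 ->
  exists z, [/\ (x <= z)%O, (z <= y)%O, i x z != 0 & j z y != 0].
Proof.
apply: contra_neqP => H; rewrite /= /convolution fsbig1 // => z [xz zy].
apply: contra_notP H => /eqP; rewrite mulf_eq0 negb_or => /andP[? ?].
by exists z.
Qed.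

Lemma controls_conv (f g : incidence) S x y :
  controls S f x y -> controls S g x y -> controls S (conv f g) x y.
Proof.
move=> cf cg u v xu vy uv /convolution_neq0[w [uw wv fn gn]].
have [Ewu|uw'] := eqVneq u w; first by move: gn; rewrite -Ewu => gn; apply: cg.
have [Ewv|wv'] := eqVneq w v; first by move: fn; rewrite Ewv => fn; apply: cf.
have /andP[-> _] := cf u w xu (le_trans wv vy) uw' fn.
by have /andP[_ ->] := cg w v (le_trans xu uw) vy wv' gn.
Qed.

Lemma conv_finitary (f g : finitary) : conv f g \in finitary_pred.
Proof.
apply/finitary_predP => x y xy; have [S [_ _ _ cf cg]] := controls_exists f g x y.
apply: (@sub_finite_set _ _ [set` [seq (u, v) | u <- S, v <- S]]); last first.
  exact: finite_seq.
move=> [u v] [/= xu uv vy nz].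
have /andP[uS vS] := controls_conv cf cg xu vy (negbT (lt_eqF uv)) nz.
by apply/allpairsP; exists (u, v).
Qed.

Definition finitary_mul (f g : finitary) : finitary :=
  Finitary (conv_finitary f g).

Lemma convolution_finite (i j : incidence) x y :
  i \in finitary_pred \/ j \in finitary_pred ->
  finite_set [set z | [/\ (x <= z)%O, (z <= y)%O & i x z * j z y != 0]].
Proof.
case=> [Pi|Pj].
- have [S [_ xS _ cS _]] := controls_exists (Finitary Pi) 0 x y.
  apply: (@sub_finite_set _ _ [set` S]); last exact: finite_seq.
  move=> z [xz zy]; rewrite mulf_eq0 negb_or => /andP[nz _] /=.
  have [<- //|xz'] := eqVneq x z.
  by have /andP[] := cS x z (lexx _) zy xz' nz.
- have [S [_ _ yS cS _]] := controls_exists (Finitary Pj) 0 x y.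
  apply: (@sub_finite_set _ _ [set` S]); last exact: finite_seq.
  move=> z [xz zy]; rewrite mulf_eq0 negb_or => /andP[_ nz] /=.
  have [-> //|zy'] := eqVneq z y.
  by have /andP[] := cS z y xz (lexx _) zy' nz.
Qed.

Lemma convDl_l (f f' : finitary) (j : incidence) (k : K) :
  conv (k *: f + f')%R j = k *: conv f j + conv f' j.
Proof.
apply: incidenceP => x y; have [S [uS xS _ cf cf']] := controls_exists f f' x y.
have cff : controls S (k *: f + f')%R x y.
  move=> u v xu vy uv; rewrite incidence_lin => nz.
  have [f0|fn0] := eqVneq (f u v) 0; last exact: cf.
  by apply: cf' => //; apply: contra nz => /eqP ->; rewrite f0 mulr0 addr0.
rewrite incidence_lin !(convolution_seql _ uS (lexx x) (lexx y)) //.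
rewrite mulr_sumr -big_split; apply: eq_bigr => z _.
by rewrite incidence_lin mulrDl mulrA.
Qed.

Lemma convDr_l (f : finitary) (i j : incidence) (k : K) :
  conv f (k *: i + j) = k *: conv f i + conv f j.
Proof.
apply: incidenceP => x y; have [S [uS xS _ cf _]] := controls_exists f f x y.
rewrite incidence_lin !(convolution_seql _ uS (lexx x) (lexx y)) //.
rewrite mulr_sumr -big_split; apply: eq_bigr => z _.
by rewrite incidence_lin mulrDr mulrCA.
Qed.

Lemma convDl_r (f : finitary) (i j : incidence) (k : K) :
  conv (k *: i + j) f = k *: conv i f + conv j f.
Proof.
apply: incidenceP => x y; have [S [uS _ yS cf _]] := controls_exists f f x y.
rewrite incidence_lin !(convolution_seqr _ uS (lexx x) (lexx y)) //.
rewrite mulr_sumr -big_split; apply: eq_bigr => z _.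
by rewrite incidence_lin mulrDl mulrA.
Qed.

Lemma convDr_r (f f' : finitary) (j : incidence) (k : K) :
  conv j (k *: f + f')%R = k *: conv j f + conv j f'.
Proof.
apply: incidenceP => x y; have [S [uS _ yS cf cf']] := controls_exists f f' x y.
have cff : controls S (k *: f + f')%R x y.
  move=> u v xu vy uv; rewrite incidence_lin => nz.
  have [f0|fn0] := eqVneq (f u v) 0; last exact: cf.
  by apply: cf' => //; apply: contra nz => /eqP ->; rewrite f0 mulr0 addr0.
rewrite incidence_lin !(convolution_seqr _ uS (lexx x) (lexx y)) //.
rewrite mulr_sumr -big_split; apply: eq_bigr => z _.
by rewrite incidence_lin mulrDr mulrCA.
Qed.

Lemma convA_seq (f g h : incidence) S x y :
  conv f (conv g h) x y = \sum_(w <- S) f x w * conv g h w y ->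
  (forall w, w \in S -> (x <= w)%O ->
    conv g h w y = \sum_(z <- S) g w z * h z y) ->
  conv (conv f g) h x y = \sum_(z <- S) conv f g x z * h z y ->
  (forall z, z \in S -> (z <= y)%O ->
    conv f g x z = \sum_(w <- S) f x w * g w z) ->
  conv f (conv g h) x y = conv (conv f g) h x y.
Proof.
move=> -> E1 -> E2.
rewrite (_ : \sum_(w <- S) _ = \sum_(w <- S) \sum_(z <- S) f x w * g w z * h z y).
  rewrite exchange_big [LHS]big_seq [RHS]big_seq; apply: eq_bigr => z zS.
  have [zy|zy] := boolP (z <= y)%O; first by rewrite E2 // mulr_suml.
  by rewrite (incidence_eq0 h zy) mulr0 big1 // => w _; rewrite mulr0.
rewrite [LHS]big_seq [RHS]big_seq; apply: eq_bigr => w wS.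
have [xw|xw] := boolP (x <= w)%O.
  by rewrite E1 // mulr_sumr; apply: eq_bigr => z _; rewrite mulrA.
by rewrite (incidence_eq0 f xw) mul0r big1 // => z _; rewrite !mul0r.
Qed.

Lemma convA_ll (f g : finitary) (i : incidence) :
  conv f (conv g i) = conv (conv f g) i.
Proof.
apply: incidenceP => x y; have [S [uS xS yS cf cg]] := controls_exists f g x y.
apply: (@convA_seq _ _ _ S).
- by apply: (@convolution_seql _ _ _ x y).
- by move=> w wS xw; apply: (@convolution_seql _ _ _ x y).
- by apply: (@convolution_seql _ _ _ x y) => //; apply: controls_conv.
- by move=> z zS zy; apply: (@convolution_seql _ _ _ x y).
Qed.

Lemma convA_lr (f g : finitary) (i : incidence) :
  conv f (conv i g) = conv (conv f i) g.
Proof.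
apply: incidenceP => x y; have [S [uS xS yS cf cg]] := controls_exists f g x y.
apply: (@convA_seq _ _ _ S).
- by apply: (@convolution_seql _ _ _ x y).
- by move=> w wS xw; apply: (@convolution_seqr _ _ _ x y).
- by apply: (@convolution_seqr _ _ _ x y).
- by move=> z zS zy; apply: (@convolution_seql _ _ _ x y).
Qed.

Lemma convA_rr (f g : finitary) (i : incidence) :
  conv i (conv f g) = conv (conv i f) g.
Proof.
apply: incidenceP => x y; have [S [uS xS yS cf cg]] := controls_exists f g x y.
apply: (@convA_seq _ _ _ S).
- by apply: (@convolution_seqr _ _ _ x y) => //; apply: controls_conv.
- by move=> w wS xw; apply: (@convolution_seqr _ _ _ x y).
- by apply: (@convolution_seqr _ _ _ x y).
- by move=> z zS zy; apply: (@convolution_seqr _ _ _ x y).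
Qed.

Lemma delta_incidence_subproof :
  (fun x y => (x == y)%:R : K) \in incidence_pred.
Proof.
by apply/incidence_predP => x y; have [->|//] := eqVneq x y; rewrite lexx.
Qed.

Definition delta_incidence : incidence := Incidence delta_incidence_subproof.

Lemma delta_finitary_subproof : delta_incidence \in finitary_pred.
Proof.
apply/finitary_predP => x y _; rewrite (_ : nonzero_subintervals _ _ _ = set0) //.
by apply/seteqP; split => // p [_ pp _] /=; rewrite (lt_eqF pp) eqxx.
Qed.

Definition delta : finitary := Finitary delta_finitary_subproof.

Lemma conv1l (i : incidence) : conv delta i = i.
Proof.
apply: incidenceP => x y; rewrite (@convolution_seq _ _ [:: x]) //.
  by rewrite big_seq1 /= eqxx mul1r.
move=> z _ _ /=; have [->|] := eqVneq x z; first by rewrite inE eqxx.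
by rewrite mul0r eqxx.
Qed.

Lemma conv1r (i : incidence) : conv i delta = i.
Proof.
apply: incidenceP => x y; rewrite (@convolution_seq _ _ [:: y]) //.
  by rewrite big_seq1 /= eqxx mulr1.
move=> z _ _ /=; have [->|] := eqVneq z y; first by rewrite inE eqxx.
by rewrite mulr0 eqxx.
Qed.

Lemma finitary_mulA : associative finitary_mul.
Proof. by move=> f g h; apply/val_inj/convA_ll. Qed.
Lemma finitary_mul1l : left_id delta finitary_mul.
Proof. by move=> f; apply/val_inj/conv1l. Qed.
Lemma finitary_mul1r : right_id delta finitary_mul.
Proof. by move=> f; apply/val_inj/conv1r. Qed.
Lemma finitary_mulDl : left_distributive finitary_mul +%R.
Proof.
by move=> f g h; apply/val_inj; have := convDl_l f g h 1; rewrite !scale1r.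
Qed.
Lemma finitary_mulDr : right_distributive finitary_mul +%R.
Proof.
by move=> f g h; apply/val_inj; have := convDr_l f g h 1; rewrite !scale1r.
Qed.

HB.instance Definition _ := GRing.Zmodule_isPzRing.Build finitary
  finitary_mulA finitary_mul1l finitary_mul1r finitary_mulDl finitary_mulDr.

Lemma conv0l (f : finitary) : conv 0 f = 0.
Proof. by have := convDl_r f 0 0 (-1); rewrite !scaleN1r !addNr. Qed.
Lemma conv0r (f : finitary) : conv f 0 = 0.
Proof. by have := convDr_l f 0 0 (-1); rewrite !scaleN1r !addNr. Qed.
Lemma conv0l_l (i : incidence) : conv (0 : finitary) i = 0.
Proof. by have := convDl_l 0 0 i (-1); rewrite !scaleN1r !addNr. Qed.
Lemma conv0r_r (i : incidence) : conv i (0 : finitary) = 0.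
Proof. by have := convDr_r 0 0 i (-1); rewrite !scaleN1r !addNr. Qed.

Lemma finitary_scalerAl (k : K) (f g : finitary) : k *: (f * g) = (k *: f) * g.
Proof.
apply/val_inj; have := convDl_l f 0 g k; rewrite addr0 => /= ->.
by rewrite conv0l_l addr0.
Qed.

Lemma finitary_scalerAr (k : K) (f g : finitary) : k *: (f * g) = f * (k *: g).
Proof.
apply/val_inj; have := convDr_l f g 0 k; rewrite addr0 => /= ->.
by rewrite conv0r addr0.
Qed.

(* incidence, finitary and idealization are I(X,K), FI(X,K) and D(X,K).
   FI(X,K) and D(X,K) carry a pzRingType and an lmodType K structure, but no
   algType structure: in MathComp this requires 1 != 0, which fails when X is
   empty. The lemmas named _scalerAl and _scalerAr are the K-algebra axioms. *)
Definition idealization : Type := (finitary * incidence)%type.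

HB.instance Definition _ := GRing.Lmodule.copy idealization (finitary * incidence)%type.

Definition idealization_mul (a b : idealization) : idealization :=
  (a.1 * b.1, conv a.1 b.2 + conv a.2 b.1).

Definition idealization_one : idealization := (1, 0).

Lemma convDrl (f : finitary) (i j : incidence) :
  conv f (i + j) = conv f i + conv f j.
Proof. by have := convDr_l f i j 1; rewrite !scale1r. Qed.
Lemma convDlr (f : finitary) (i j : incidence) :
  conv (i + j) f = conv i f + conv j f.
Proof. by have := convDl_r f i j 1; rewrite !scale1r. Qed.
Lemma convDll (f g : finitary) (i : incidence) :
  conv (f + g)%R i = conv f i + conv g i.
Proof. by have := convDl_l f g i 1; rewrite !scale1r. Qed.
Lemma convDrr (f g : finitary) (i : incidence) :
  conv i (f + g)%R = conv i f + conv i g.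
Proof. by have := convDr_r f g i 1; rewrite !scale1r. Qed.
Lemma convZrl (k : K) (f : finitary) (i : incidence) :
  conv f (k *: i) = k *: conv f i.
Proof. by have := convDr_l f i 0 k; rewrite conv0r !addr0. Qed.
Lemma convZlr (k : K) (f : finitary) (i : incidence) :
  conv (k *: i) f = k *: conv i f.
Proof. by have := convDl_r f i 0 k; rewrite conv0l !addr0. Qed.
Lemma convZll (k : K) (f : finitary) (i : incidence) :
  conv (k *: f) i = k *: conv f i.
Proof. by have := convDl_l f 0 i k; rewrite conv0l_l !addr0. Qed.
Lemma convZrr (k : K) (f : finitary) (i : incidence) :
  conv i (k *: f) = k *: conv i f.
Proof. by have := convDr_r f 0 i k; rewrite conv0r_r !addr0. Qed.

Lemma idealization_mulA : associative idealization_mul.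
Proof.
move=> [f i] [g j] [h l]; congr pair => /=; first exact: mulrA.
by rewrite convDrl convDlr convA_ll convA_lr convA_rr addrA.
Qed.
Lemma idealization_mul1l : left_id idealization_one idealization_mul.
Proof. by move=> [f i]; congr pair => /=; rewrite ?mul1r // conv1l conv0l addr0. Qed.
Lemma idealization_mul1r : right_id idealization_one idealization_mul.
Proof. by move=> [f i]; congr pair => /=; rewrite ?mulr1 // conv1r conv0r add0r. Qed.
Lemma idealization_mulDl : left_distributive idealization_mul +%R.
Proof.
move=> [f i] [g j] [h l]; congr pair => /=; first exact: mulrDl.
by rewrite convDll convDlr addrACA.
Qed.
Lemma idealization_mulDr : right_distributive idealization_mul +%R.
Proof.
move=> [f i] [g j] [h l]; congr pair => /=; first exact: mulrDr.
by rewrite convDrl convDrr addrACA.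
Qed.

HB.instance Definition _ := GRing.Zmodule_isPzRing.Build idealization
  idealization_mulA idealization_mul1l idealization_mul1r
  idealization_mulDl idealization_mulDr.

Lemma idealization_scalerAl (k : K) (a b : idealization) :
  k *: (a * b) = (k *: a) * b.
Proof.
case: a b => [f i] [g j]; congr pair => /=; first exact: finitary_scalerAl.
by rewrite scalerDr convZll convZlr.
Qed.

Lemma idealization_scalerAr (k : K) (a b : idealization) :
  k *: (a * b) = a * (k *: b).
Proof.
case: a b => [f i] [g j]; congr pair => /=; first exact: finitary_scalerAr.
by rewrite scalerDr convZrl convZrr.
Qed.

Definition algebra_automorphism (Psi : idealization -> idealization) : Prop :=
  [/\ linear Psi, Psi 1 = 1, {morph Psi : a b / a * b} & bijective Psi].

Definition is_involution (phi : idealization -> idealization) : Prop :=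
  [/\ linear phi, forall a b, phi (a * b) = phi b * phi a & involutive phi].

Definition equivalent_involutions (phi psi : idealization -> idealization) : Prop :=
  exists Psi : idealization -> idealization,
    algebra_automorphism Psi /\ Psi \o phi =1 psi \o Psi.

Definition inner_equivalent_involutions
    (phi psi : idealization -> idealization) : Prop :=
  exists Psi : idealization -> idealization,
    inner_automorphism Psi /\ Psi \o phi =1 psi \o Psi.

Definition is_multiplicative (sigma : incidence) : Prop :=
  (forall x y, (x <= y)%O -> sigma x y != 0) /\
  (forall x y z, (x <= y)%O -> (y <= z)%O ->
     sigma x y * sigma y z = sigma x z).

Lemma pointwise_incidence (i j : incidence) :
  (fun x y => i x y * j x y) \in incidence_pred.
Proof. by apply/incidence_predP => x y /(incidence_eq0 i) ->; rewrite mul0r. Qed.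

Lemma pointwise_finitary (s : incidence) (f : finitary) :
  Incidence (pointwise_incidence s f) \in finitary_pred.
Proof.
apply/finitary_predP => x y xy; apply: sub_finite_set (finitary_finite f xy).
by move=> p [? ? ?] /=; rewrite mulf_eq0 negb_or => /andP[_ ?]; split.
Qed.

Definition multiplicative_map (sigma : incidence) (f : finitary) : finitary :=
  Finitary (pointwise_finitary sigma f).

Definition is_derivation (D : finitary -> incidence) : Prop :=
  linear D /\ forall f g : finitary, D (f * g) = conv (D f) g + conv f (D g).

Definition is_inner_derivation (D : finitary -> incidence) : Prop :=
  exists i : incidence, forall f : finitary, D f = conv f i - conv i f.

Lemma relabel_incidence (a : poset_automorphism X) (i : incidence) :
  (fun x y => i (pa_inv a x) (pa_inv a y)) \in incidence_pred.
Proof.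
by apply/incidence_predP => x y xy; rewrite incidence_eq0 // pa_inv_mono.
Qed.

Definition incidence_relabel (a : poset_automorphism X) (i : incidence) : incidence :=
  Incidence (relabel_incidence a i).

Lemma relabel_finitary (a : poset_automorphism X) (f : finitary) :
  incidence_relabel a f \in finitary_pred.
Proof.
apply/finitary_predP => x y xy.
have xy' : (pa_inv a x <= pa_inv a y)%O by rewrite pa_inv_mono.
apply: sub_finite_set (finite_image (fun p => (a p.1, a p.2)) (finitary_finite f xy')).
move=> p [xp pp py nz]; exists (pa_inv a p.1, pa_inv a p.2); last first.
  by rewrite /= !pa_invK; case: (p).
by split => //=; rewrite ?pa_inv_mono // (leW_mono (pa_inv_mono a)).
Qed.

Definition finitary_relabel (a : poset_automorphism X) (f : finitary) : finitary :=
  Finitary (relabel_finitary a f).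

Definition tilde_aut (a : poset_automorphism X) (b : idealization) : idealization :=
  (finitary_relabel a b.1, incidence_relabel a b.2).

Definition tilde_scale (k : K) (b : idealization) : idealization :=
  (b.1, k *: b.2).

Lemma inner_automorphismW (Psi : idealization -> idealization) :
  inner_automorphism Psi -> algebra_automorphism Psi.
Proof.
move=> [u [v [uv vu E]]]; split.
- move=> k a b; rewrite !E mulrDr mulrDl.
  by rewrite -idealization_scalerAr -idealization_scalerAl.
- by rewrite E mulr1.
- by move=> a b; rewrite !E !mulrA -(mulrA _ v u) vu mulr1.
- exists (fun a => v * a * u) => a; rewrite E.
    by rewrite !mulrA vu mul1r -mulrA vu mulr1.
  by rewrite !mulrA uv mul1r -mulrA uv mulr1.
Qed.

Lemma algebra_automorphism_comp (Psi Theta : idealization -> idealization) :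
  algebra_automorphism Psi -> algebra_automorphism Theta ->
  algebra_automorphism (Psi \o Theta).
Proof.
move=> [lP P1 mP bP] [lT T1 mT bT]; split.
- by move=> k a b; rewrite /= lT lP.
- by rewrite /= T1 P1.
- by move=> a b; rewrite /= mT mP.
- exact: bij_comp.
Qed.

Lemma incidence_relabelK (a : poset_automorphism X) :
  cancel (incidence_relabel a) (incidence_relabel (poset_automorphism_inverse a)).
Proof. by move=> i; apply: incidenceP => x y /=; rewrite !pa_funK. Qed.

Lemma incidence_relabelVK (a : poset_automorphism X) :
  cancel (incidence_relabel (poset_automorphism_inverse a)) (incidence_relabel a).
Proof. by move=> i; apply: incidenceP => x y /=; rewrite !pa_invK. Qed.

Lemma tilde_autK (a : poset_automorphism X) :
  cancel (tilde_aut a) (tilde_aut (poset_automorphism_inverse a)).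
Proof.
by move=> [f i]; congr pair; [apply/val_inj|]; apply: incidence_relabelK.
Qed.

Lemma tilde_autVK (a : poset_automorphism X) :
  cancel (tilde_aut (poset_automorphism_inverse a)) (tilde_aut a).
Proof.
by move=> [f i]; congr pair; [apply/val_inj|]; apply: incidence_relabelVK.
Qed.

Lemma incidence_relabel_conv (a : poset_automorphism X) (i j : incidence) :
  incidence_relabel a (conv i j) =
  conv (incidence_relabel a i) (incidence_relabel a j).
Proof.
apply: incidenceP => x y; rewrite /= /convolution.
rewrite (reindex_fsbig (pa_inv a)
  [set z | (x <= z)%O /\ (z <= y)%O]) //.
split.
- by move=> z [xz zy] /=; rewrite !pa_inv_mono.
- by move=> z z' _ _ /(can_inj (pa_invK a)).
- move=> z /= [xz zy]; exists (a z); last by rewrite pa_funK.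
  by split; rewrite -(pa_inv_mono a) pa_funK.
Qed.

Lemma tilde_aut_automorphism (a : poset_automorphism X) :
  algebra_automorphism (tilde_aut a).
Proof.
split.
- by move=> k [f i] [g j]; congr pair; [apply/val_inj|]; apply: incidenceP.
- congr pair; [apply: finitaryP|apply: incidenceP] => x y //=.
  by rewrite (can_eq (pa_invK a)).
- move=> [f i] [g j]; congr pair.
    by apply/val_inj/incidence_relabel_conv.
  rewrite -[in RHS]/(_ + _) -!incidence_relabel_conv.
  exact: incidenceP.
- by exists (tilde_aut (poset_automorphism_inverse a));
    [exact: tilde_autK|exact: tilde_autVK].
Qed.

Lemma tilde_scaleK (k : K) : k != 0 -> cancel (tilde_scale k) (tilde_scale k^-1).
Proof.
by move=> k0 [f i]; rewrite /tilde_scale /= scalerA mulVf // scale1r.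
Qed.

Lemma tilde_scaleVK (k : K) : k != 0 -> cancel (tilde_scale k^-1) (tilde_scale k).
Proof.
by move=> k0 [f i]; rewrite /tilde_scale /= scalerA mulfV // scale1r.
Qed.

Lemma tilde_scale_automorphism (k : K) : k != 0 ->
  algebra_automorphism (tilde_scale k).
Proof.
move=> k0; split.
- move=> c [f i] [g j]; congr pair => /=.
  by rewrite scalerDr !scalerA mulrC.
- by congr pair; rewrite /= scaler0.
- by move=> [f i] [g j]; congr pair; rewrite /= scalerDr convZrl convZlr.
- by exists (tilde_scale k^-1); [exact: tilde_scaleK|exact: tilde_scaleVK].
Qed.

Lemma conjugate_involution (Psi Theta phi : idealization -> idealization) :
  algebra_automorphism Psi -> cancel Psi Theta -> cancel Theta Psi ->
  is_involution phi -> is_involution (Psi \o phi \o Theta).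
Proof.
move=> [lP _ mP _] PT TP [lp mp ip]; split.
- move=> k a b /=; have -> : Theta (k *: a + b) = k *: Theta a + Theta b.
    by apply: (can_inj PT); rewrite TP lP !TP.
  by rewrite lp lP.
- move=> a b; have -> : (Psi \o phi \o Theta) (a * b) = Psi (phi (Theta a * Theta b)).
    by rewrite /=; congr (Psi (phi _)); apply: (can_inj PT); rewrite TP mP !TP.
  by rewrite mp mP.
- by move=> a; rewrite /= PT ip TP.
Qed.

Lemma twisted_involution (a : poset_automorphism X) (k : K)
    (phi : idealization -> idealization) :
  k != 0 -> is_involution phi ->
  is_involution (tilde_aut a \o tilde_scale k \o phi \o tilde_scale k^-1
                 \o tilde_aut (poset_automorphism_inverse a)).
Proof.
move=> k0 ip.
apply: (@conjugate_involution (tilde_aut a)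
  (tilde_aut (poset_automorphism_inverse a))
  (tilde_scale k \o phi \o tilde_scale k^-1)).
- exact: tilde_aut_automorphism.
- exact: tilde_autK.
- exact: tilde_autVK.
- by apply: conjugate_involution => //; [exact: tilde_scale_automorphism
    |exact: tilde_scaleK|exact: tilde_scaleVK].
Qed.

End IncidenceSpace.

(* Main.v *)
Require Import Defs.
From mathcomp Require Import all_boot all_order all_algebra.
From mathcomp Require Import boolp classical_sets cardinality.

Set Implicit Arguments.
Unset Strict Implicit.
Unset Printing Implicit Defensive.

Import Order.TTheory GRing.Theory.
Local Open Scope ring_scope.

(** The theorem follows from a decomposition of the automorphisms of D(X,K):
    each is the composition of an inner automorphism, some alpha~ and some
    (k delta)~ ([automorphism_decomposition]). Indeed, let Psi be an
    automorphism with Psi o Phi1 = Phi2 o Psi, and write its inverse as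
    Inn o alpha~ o (k delta)~. Then alpha~ o (k delta)~ o Psi is inner and
    intertwines Phi1 with the twist of Phi2 by alpha and k. The converse is a
    composition of automorphisms.

    The decomposition is obtained by following the primitive idempotents e_x,
    x in X. An element of D(X,K) whose first component has diagonal entries 1
    is invertible ([idealization_invertible]), because a finitary function with
    zero diagonal is nilpotent on each interval. Hence every
    idempotent is conjugate to its diagonal ([idempotent_conj]). As e_x D e_x is a ring of dual numbers,
    without nontrivial idempotents, Psi(e_x) is conjugate to a single e_(alpha x)
    ([aut_point]), and alpha is a poset automorphism because x <= y holds exactly
    when e_x D e_y is nonzero ([induced_poset_automorphism]).

    After composing with the inverse of alpha~, the diagonal of Psi(e_x) is
    that of e_x. Let u be the element whose row at p is the row at p of
    Psi(e_p). Then u Psi(e_x) = e_x u, and u is invertible. The point is that u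
    is finitary ([rows_finitary_subproof]): otherwise some interval [x, y]
    contains infinitely many p for which there is a minimal q(p) > p such that
    the entry of Psi(e_p) at (p, q(p)) is nonzero. A
    combinatorial lemma ([infinite_independent_subset]) gives an infinite set Y of such p with q(Y) disjoint from Y. The single
    finitary function Psi(e_Y) then has a nonzero entry at (p, q(p)) for every
    p in Y, a contradiction.

    Finally, assume that Psi fixes every e_x. Then Psi acts on each
    two-dimensional corner e_x D e_y separately, multiplying the first
    component by a multiplicative sigma and the second by k sigma, where k is a
    constant since X is connected, and adding a map from the first component to
    the second ([normalized_entries], [normalized_scalar]). As the
    multiplicative automorphism given by sigma is inner, one may take sigma = 1;
    the map from FI(X,K) to I(X,K) is then a derivation, hence inner, and an
    inner derivation comes from conjugation by a unipotent (1, j)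
    ([normalized_inner]). *)

(** * Infinite independent sets and minimal elements *)

Section Combinatorics.
Local Open Scope classical_set_scope.

(** A map without fixed points moves some infinite subset of a given infinite
    set off itself. *)
Lemma infinite_independent_subset (T : Type) (P : set T) (q : T -> T) :
  (forall p, P p -> q p <> p) -> infinite_set P ->
  exists Y : set T, [/\ Y `<=` P, infinite_set Y &
    forall a b, Y a -> Y b -> q a <> b].
Proof.
move=> qP infP.
(* A maximal independent set A will do if it is infinite. Otherwise, by
   maximality, the part of P outside A and its image is covered by the fibres
   of q over A, so that one fibre is infinite, and it is independent. *)
have [|A [[AP indA] maxA]] := @Zorn_bigcup T
  (fun A => A `<=` P /\ forall a b, A a -> A b -> q a <> b).
  move=> F FP totF; split; first by move=> t [A FA At]; apply: (FP _ FA).1.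
  move=> a b [A FA Aa] [B FB Bb].
  have [AB|BA] := totF _ _ FA FB; first by apply: (FP _ FB).2 => //; apply: AB.
  by apply: (FP _ FA).2 => //; apply: BA.
have [finA|] := pselect (finite_set A); last by exists A.
have [[a Aa infa]|nofib] :=
    pselect (exists2 a, A a & infinite_set [set p | P p /\ q p = a]).
  exists [set p | P p /\ q p = a]; split=> //; first by move=> p [].
  move=> p p' [_ qpa] [Pp' qp'a] qpp'; apply: (qP _ Pp').
  by rewrite qp'a -qpa qpp'.
exfalso; apply: infP.
apply: (@sub_finite_set _ _
  (A `|` [set q a | a in A] `|` \bigcup_(a in A) [set p | P p /\ q p = a])).
  move=> p Pp; apply: contrapT => Np.
  have Ap : ~ A p by move=> ?; apply: Np; do 2 left.
  apply: (maxA (p |` A)).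
    by split=> [t|sub]; [right|apply/Ap/sub; left].
  split; first by move=> t [->//|/AP].
  move=> s t [->|As] [->|At].
  - exact: qP.
  - by move=> qpt; apply: Np; right; exists t.
  - by move=> qsp; apply: Np; left; right; exists s.
  - exact: indA.
rewrite !finite_setU; split; first by split=> //; apply: finite_image.
apply: bigcup_finite => // a Aa; apply: contrapT => fib.
by apply: nofib; exists a.
Qed.

Lemma finite_minimal d (X : porderType d) (A : set X) :
  finite_set A -> A !=set0 ->
  exists2 m, A m & forall z, A z -> ~~ (z < m)%O.
Proof.
move=> /finite_seqP[s ->] {A}.
elim: s => [[x]//|x s IH _].
have [[y ys]|s0] := pselect ([set` s] !=set0); last first.
  exists x; first by rewrite /= mem_head.
  move=> z /=; rewrite inE => /predU1P[->|zs]; first by rewrite ltxx.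
  by case: s0; exists z.
have [|m ms minm] := IH; first by exists y.
have [xm|xm] := boolP (x < m)%O.
  exists x; first by rewrite /= mem_head.
  move=> z /=; rewrite inE => /predU1P[->|zs]; first by rewrite ltxx.
  by apply: contra (minm z zs) => /lt_trans; apply.
exists m; first by rewrite /= inE ms orbT.
by move=> z /=; rewrite inE => /predU1P[->//|/minm].
Qed.

End Combinatorics.

(** * Diagonal and invertible elements *)

Section Elements.
Variables (d : Order.disp_t) (X : porderType d) (K : fieldType).
Local Notation I := (incidence X K).
Local Notation FI := (finitary X K).
Local Notation D := (idealization X K).
Implicit Types (a b c : D) (f g : FI) (i j : I) (w : X -> K) (x y z : X).

Lemma idealizationP a b : (forall x y, a.1 x y = b.1 x y) ->
  (forall x y, a.2 x y = b.2 x y) -> a = b.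
Proof.
case: a b => [f i] [g j] /= fg ij; congr pair.
  exact: finitaryP.
exact: incidenceP.
Qed.

Lemma idealization_mul1E a b : (a * b).1 = a.1 * b.1. Proof. by []. Qed.
Lemma idealization_mul2E a b : (a * b).2 = conv a.1 b.2 + conv a.2 b.1.
Proof. by []. Qed.

Lemma conv_diagonal i j x : conv i j x x = i x x * j x x.
Proof.
rewrite (@convolution_seq _ _ _ _ _ [:: x]) // ?big_seq1 // => z xz zx _.
by rewrite inE; apply/eqP/le_anti; rewrite zx.
Qed.

Lemma mul_diagonal a b x : (a * b).1 x x = a.1 x x * b.1 x x.
Proof. exact: conv_diagonal. Qed.

Lemma diagonal_incidence_subproof w :
  (fun x y => w x * (x == y)%:R) \in @incidence_pred _ X K.
Proof.
apply/incidence_predP => x y; have [->|_ _] := eqVneq x y; first by rewrite lexx.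
by rewrite mulr0.
Qed.

Lemma diagonal_finitary_subproof w :
  Incidence (diagonal_incidence_subproof w) \in @finitary_pred _ X K.
Proof.
apply/finitary_predP => x y _.
apply: (sub_finite_set _ (finite_set0 _)) => p [_ pp _] /=.
by rewrite (lt_eqF pp) mulr0 eqxx.
Qed.

(** The element of FI(X,K) with diagonal w and zero off-diagonal entries. *)
Definition finitary_diagonal w : FI := Finitary (diagonal_finitary_subproof w).

Lemma conv_diagonall w i x y : conv (finitary_diagonal w) i x y = w x * i x y.
Proof.
rewrite (@convolution_seq _ _ _ _ _ [:: x]) //.
  by rewrite big_seq1 /= eqxx mulr1.
move=> z _ _ /=; have [->|] := eqVneq x z; first by rewrite inE eqxx.
by rewrite mulr0 mul0r eqxx.
Qed.

Lemma conv_diagonalr w i x y : conv i (finitary_diagonal w) x y = i x y * w y.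
Proof.
rewrite (@convolution_seq _ _ _ _ _ [:: y]) //.
  by rewrite big_seq1 /= eqxx mulr1.
move=> z _ _ /=; have [->|] := eqVneq z y; first by rewrite inE eqxx.
by rewrite !mulr0 eqxx.
Qed.

Lemma mul_diagonall w f x y : (finitary_diagonal w * f) x y = w x * f x y.
Proof. exact: conv_diagonall. Qed.
Lemma mul_diagonalr w f x y : (f * finitary_diagonal w) x y = f x y * w y.
Proof. exact: conv_diagonalr. Qed.

(** The diagonal element of D(X,K) given by w; its second component is 0. *)
Definition diag w : D := (finitary_diagonal w, 0).

Lemma diag_mul1 w a x y : (diag w * a).1 x y = w x * a.1 x y.
Proof. exact: conv_diagonall. Qed.
Lemma diag_mul2 w a x y : (diag w * a).2 x y = w x * a.2 x y.
Proof. by rewrite idealization_mul2E conv0l addr0 conv_diagonall. Qed.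
Lemma mul_diag1 w a x y : (a * diag w).1 x y = a.1 x y * w y.
Proof. exact: conv_diagonalr. Qed.
Lemma mul_diag2 w a x y : (a * diag w).2 x y = a.2 x y * w y.
Proof. by rewrite idealization_mul2E conv0r add0r conv_diagonalr. Qed.

Lemma diag_mul w w' : diag w * diag w' = diag (fun x => w x * w' x).
Proof.
apply: idealizationP => x y; first by rewrite diag_mul1 /= mulrA.
by rewrite diag_mul2 mulr0.
Qed.

(** A nonzero entry at (u, v) of the k-th power of a function with zero
    diagonal requires at least k elements s of the control set S with u <= s < v. *)
Lemma nilpotent_on f S x y : uniq S ->
  controls S f x y -> (forall z, f z z = 0) ->
  forall k u v, (x <= u)%O -> (v <= y)%O -> (f ^+ k) u v != 0 ->
    (k <= count (fun s => (u <= s)%O && (s < v)%O) S)%N.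
Proof.
move=> uS cf f0; elim=> // k IH u v xu vy.
rewrite exprS => /convolution_neq0[z [uz zv fuz fzv]].
have uz' : u != z by apply: contraNneq fuz => <-; rewrite f0.
have ltuz : (u < z)%O by rewrite lt_neqAle uz'.
have /andP[uS' _] := cf u z xu (le_trans zv vy) uz' fuz.
have := IH z v (le_trans xu uz) vy fzv.
rewrite -!size_filter => le1; apply: leq_ltn_trans le1 _.
apply: (@uniq_leq_size _ (u :: [seq s <- S | (z <= s)%O && (s < v)%O])).
  by rewrite /= filter_uniq // mem_filter lt_geF.
move=> s; rewrite inE mem_filter => /predU1P[->|/andP[/andP[zs sv] sS]].
  by rewrite mem_filter lexx (lt_le_trans ltuz zv).
by rewrite mem_filter (le_trans uz zs) sv.
Qed.

Lemma controls_exp f S x y k : controls S f x y -> controls S (f ^+ k) x y.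
Proof.
move=> cf; elim: k => [|k IH].
  by move=> u v _ _ uv; rewrite expr0 /= (negPf uv) eqxx.
by rewrite exprS; apply: controls_conv.
Qed.

Lemma finitary_sumE (s : seq nat) (F : nat -> FI) x y :
  (\sum_(k <- s) F k) x y = \sum_(k <- s) F k x y.
Proof. by elim: s => [|k s IH]; rewrite ?big_nil // !big_cons -IH. Qed.

(** The inverse of f = 1 - n is the geometric series in n. Each entry of it is a
    finite sum; on an interval [x, y] one truncation serves all entries, and the
    finite set S that controls n also controls the series. *)
Lemma finitary_right_inverse f : (forall x, f x x = 1) ->
  exists g, f * g = 1.
Proof.
move=> f1; pose n := 1 - f.
have n0 z : n z z = 0 by rewrite -[LHS]/(delta X K z z - f z z) f1 /= eqxx subrr.
have nil x y S : uniq S -> controls S n x y ->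
    forall k u v, (x <= u)%O -> (v <= y)%O -> (size S < k)%N -> (n ^+ k) u v = 0.
  move=> uS cn k u v xu vy; apply: contraTeq => nz; rewrite -leqNgt.
  exact: leq_trans (nilpotent_on uS cn n0 xu vy nz) (count_size _ _).
have /choice[N HN] : forall xy : X * X, exists N, forall k, (N <= k)%N ->
    (n ^+ k) xy.1 xy.2 = 0.
  move=> [x y]; have [S [uS xS yS cn _]] := controls_exists n n x y.
  by exists (size S).+1 => k; apply: (nil x y S).
pose G M : FI := \sum_(0 <= k < M) n ^+ k.
have GE M x y : (forall k, (M <= k)%N -> (n ^+ k) x y = 0) ->
    G (N (x, y)) x y = G M x y.
  move=> HM.
  have aux M1 M2 : (M1 <= M2)%N ->
      (forall k, (M1 <= k)%N -> (n ^+ k) x y = 0) -> G M2 x y = G M1 x y.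
    move=> le12 H1; rewrite /G !finitary_sumE (big_cat_nat _ le12) //=.
    rewrite [X in _ + X]big_nat_cond [X in _ + X]big1 ?addr0 //.
    by move=> k /andP[/andP[? _] _]; apply: H1.
  case/orP: (leq_total (N (x, y)) M) => [le|le]; last exact: aux.
  by rewrite (aux _ _ le) // => k; apply: (HN (x, y)).
have Ginc : (fun x y => G (N (x, y)) x y) \in @incidence_pred _ X K.
  by apply/incidence_predP => x y; apply: incidence_eq0.
have Gfin : Incidence Ginc \in @finitary_pred _ X K.
  apply/finitary_predP => x y xy.
  have [S [uS xS yS cn _]] := controls_exists n n x y.
  apply: (@sub_finite_set _ _ [set` [seq (u, v) | u <- S, v <- S]]%classic);
    last exact: finite_seq.
  move=> [u v] [/= xu uv vy nz].
  have [k kn] : exists k, (n ^+ k) u v != 0.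
    apply: contrapT => Nk; case/negP: nz; rewrite finitary_sumE big1 // => k _.
    by apply/eqP; apply: contrapT => /negP ?; apply: Nk; exists k.
  have /andP[uS' vS] := controls_exp cn xu vy (negbT (lt_eqF uv)) kn.
  by apply/allpairsP; exists (u, v).
exists (Finitary Gfin); apply: finitaryP => x y.
have [S [uS xS yS cn cf]] := controls_exists n f x y.
have HG z : (x <= z)%O -> Incidence Ginc z y = G (size S).+1 z y.
  move=> xz; rewrite /=; apply: GE => k Hk; exact: (nil x y S).
transitivity ((f * G (size S).+1) x y).
  rewrite -[LHS]/(conv f (Incidence Ginc) x y).
  rewrite -[RHS]/(conv f (G (size S).+1) x y).
  rewrite !(convolution_seql _ uS (lexx x) (lexx y)) //.
  apply: eq_bigr => z _; have [xz|xz] := boolP (x <= z)%O; first by rewrite HG.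
  by rewrite (incidence_eq0 f xz) !mul0r.
have -> : f * G (size S).+1 = 1 - n ^+ (size S).+1.
  have fE : f = - (n - 1) by rewrite opprB subKr.
  by rewrite {1}fE /G big_mkord mulNr -subrX1 opprB.
rewrite -[LHS]/(delta X K x y - (n ^+ (size S).+1) x y).
by rewrite (nil x y S) ?subr0.
Qed.

Lemma idealization_right_inverse a : (forall x, a.1 x x = 1) ->
  exists b, a * b = 1.
Proof.
move=> /finitary_right_inverse[g fg].
exists (g, - conv g (conv a.2 g)); apply: idealizationP => x y.
  by rewrite idealization_mul1E fg.
rewrite idealization_mul2E -[(_, _).2]/(- conv g (conv a.2 g)) -scaleN1r convZrl.
rewrite convA_ll -[conv a.1 g]/(finitary_incidence (a.1 * g)) fg conv1l !scaleN1r.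
by rewrite addNr.
Qed.

(** A right inverse again has diagonal 1, hence a right inverse of its own, so
    that it is two-sided. *)
Lemma idealization_invertible a : (forall x, a.1 x x = 1) ->
  exists b, a * b = 1 /\ b * a = 1.
Proof.
move=> a1; have [b ab] := idealization_right_inverse a1.
have [|c bc] := @idealization_right_inverse b.
  move=> x; have := mul_diagonal a b x; rewrite ab a1 mul1r => <-.
  by rewrite /= eqxx.
exists b; split=> //; suff -> : a = c by [].
by rewrite -[LHS]mulr1 -bc mulrA ab mul1r.
Qed.

End Elements.

(** * Idempotents of D(X,K) *)

Section Idempotents.
Variables (d : Order.disp_t) (X : porderType d) (K : fieldType).
Local Notation I := (incidence X K).
Local Notation FI := (finitary X K).
Local Notation D := (idealization X K).
Implicit Types (a b c E : D) (i : I) (x y z : X).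

(** The primitive idempotent e_x: its first component is 1 at (x, x) and 0
    elsewhere. *)
Definition point_idempotent x : D := diag (fun z => (z == x)%:R).
Local Notation e := (@point_idempotent).

Lemma point_mul1 x a y z : (e x * a).1 y z = (y == x)%:R * a.1 y z.
Proof. exact: diag_mul1. Qed.
Lemma point_mul2 x a y z : (e x * a).2 y z = (y == x)%:R * a.2 y z.
Proof. exact: diag_mul2. Qed.
Lemma mul_point1 x a y z : (a * e x).1 y z = a.1 y z * (z == x)%:R.
Proof. exact: mul_diag1. Qed.
Lemma mul_point2 x a y z : (a * e x).2 y z = a.2 y z * (z == x)%:R.
Proof. exact: mul_diag2. Qed.
Definition pointE := (point_mul1, point_mul2, mul_point1, mul_point2).

Lemma point_diagonal x z : (e x).1 z z = (z == x)%:R.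
Proof. by rewrite /= eqxx mulr1. Qed.

Lemma point_mul_point x y : e x * e y = (x == y)%:R *: e x.
Proof.
apply: idealizationP => z t; rewrite pointE /=.
  have [->|zx] := eqVneq z x; last by rewrite !mul0r mulr0.
  by rewrite !mul1r.
by rewrite !mulr0.
Qed.

Lemma point_idem x : e x * e x = e x.
Proof. by rewrite point_mul_point eqxx scale1r. Qed.

Lemma point_neq0 x : e x <> 0.
Proof.
move=> /(congr1 (fun a : D => a.1 x x)); rewrite point_diagonal eqxx.
by apply/eqP/oner_neq0.
Qed.

Lemma idempotent_diagonal E x : E * E = E -> E.1 x x = 0 \/ E.1 x x = 1.
Proof.
move=> EE; have : E.1 x x * (E.1 x x - 1) = 0.
  by rewrite mulrBr mulr1 -mul_diagonal EE subrr.
move/eqP; rewrite mulf_eq0 subr_eq0 => /orP[] /eqP ->; [by left|by right].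
Qed.

(** Every idempotent is conjugate to its diagonal. *)
Lemma idempotent_conj E : E * E = E ->
  exists u v, [/\ u * v = 1, v * u = 1 & u * E = diag (fun x => E.1 x x) * u].
Proof.
move=> EE; set Ed := diag _.
have EdEd : Ed * Ed = Ed.
  rewrite diag_mul; apply: idealizationP => x y //=.
  by case: (idempotent_diagonal x EE) => ->; rewrite ?mulr0 ?mulr1.
(* u = Ed E + (1 - Ed)(1 - E) has diagonal 1, as the diagonal of E is 0 or 1,
   and u E = Ed E = Ed u. *)
have [|v [uv vu]] := @idealization_invertible _ _ _ (Ed * E + (1 - Ed) * (1 - E)).
  move=> x; rewrite -[LHS]/((Ed * E).1 x x + ((1 - Ed) * (1 - E)).1 x x).
  rewrite !mul_diagonal -[Ed.1 x x]/(E.1 x x * _) eqxx mulr1.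
  rewrite -[(1 - E).1 x x]/((x == x)%:R - E.1 x x).
  rewrite -[(1 - Ed).1 x x]/((x == x)%:R - E.1 x x * (x == x)%:R) eqxx mulr1.
  by case: (idempotent_diagonal x EE) => ->;
    rewrite ?mulr1 ?subr0 ?subrr ?mulr0 ?add0r ?addr0 ?mulr1.
exists (Ed * E + (1 - Ed) * (1 - E)), v; split=> //.
have -> : (Ed * E + (1 - Ed) * (1 - E)) * E = Ed * E.
  by rewrite mulrDl -!mulrA EE (mulrBl E) mul1r EE subrr mulr0 addr0.
by rewrite mulrDr !mulrA EdEd (mulrBr Ed) mulr1 EdEd subrr mul0r addr0.
Qed.

(** The corner e_x D e_x is a ring of dual numbers over K, so that its only
    idempotents are 0 and e_x. *)
Lemma point_local E x : E * E = E -> e x * E = E -> E * e x = E ->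
  E = 0 \/ E = e x.
Proof.
move=> EE eE Ee.
have E1 y z : E.1 y z = (y == x)%:R * (E.1 x x * (z == x)%:R).
  rewrite -{1}eE -{1}Ee !pointE.
  have [->|yx] := eqVneq y x; last by rewrite !mul0r.
  by have [->//|zx] := eqVneq z x; rewrite !mulr0.
have E2 y z : E.2 y z = (y == x)%:R * (E.2 x x * (z == x)%:R).
  rewrite -{1}eE -{1}Ee !pointE.
  have [->|yx] := eqVneq y x; last by rewrite !mul0r.
  by have [->//|zx] := eqVneq z x; rewrite !mulr0.
have EE2 : E.2 x x = E.1 x x * E.2 x x + E.2 x x * E.1 x x.
  rewrite -{1}EE; rewrite -[LHS]/(conv E.1 E.2 x x + conv E.2 E.1 x x).
  by rewrite !conv_diagonal.
have E2x : E.2 x x = 0.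
  move: EE2; case: (idempotent_diagonal x EE) => ->.
    by rewrite mul0r mulr0 addr0.
  rewrite mul1r mulr1 -{1}[E.2 x x]addr0.
  by move/addrI.
case: (idempotent_diagonal x EE) => Ex; [left|right];
  apply: idealizationP => y z; rewrite 1?E1 1?E2 ?E2x ?Ex /= ?mul0r ?mulr0 //.
rewrite mul1r; have [->|yx] := eqVneq y x; last by rewrite !mul0r.
by rewrite eq_sym.
Qed.

End Idempotents.

(** * The poset automorphism induced by an automorphism of D(X,K) *)

Section Automorphism.
Variables (d : Order.disp_t) (X : porderType d) (K : fieldType).
Local Notation D := (idealization X K).
Local Notation e := (@point_idempotent _ X K).
Variable Psi : D -> D.
Hypothesis autPsi : algebra_automorphism Psi.

Lemma autD a b : Psi (a + b) = Psi a + Psi b.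
Proof. by have [l _ _ _] := autPsi; have := l 1 a b; rewrite !scale1r. Qed.
Lemma aut0 : Psi 0 = 0.
Proof. by apply: (addrI (Psi 0)); rewrite -autD !addr0. Qed.
Lemma autZ k a : Psi (k *: a) = k *: Psi a.
Proof. by have [l _ _ _] := autPsi; rewrite -[k *: a]addr0 l aut0 addr0. Qed.
Lemma autM a b : Psi (a * b) = Psi a * Psi b.
Proof. by have [_ _ m _] := autPsi. Qed.
Lemma aut1 : Psi 1 = 1.
Proof. by have [_ o _ _] := autPsi. Qed.
Lemma aut_inj : injective Psi.
Proof. by have [_ _ _ /bij_inj] := autPsi. Qed.

Lemma aut_inverse :
  exists2 Theta, algebra_automorphism Theta & cancel Psi Theta /\ cancel Theta Psi.
Proof.
have [_ _ _ [Theta PT TP]] := autPsi.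
exists Theta => //; split; last by exists Psi.
- by move=> k a b; apply: aut_inj; rewrite autD autZ !TP.
- by apply: aut_inj; rewrite TP aut1.
- by move=> a b; apply: aut_inj; rewrite autM !TP.
Qed.

(** If y is in the support of the diagonal of E = Psi(e_x), the conjugate F of
    e_y is a nonzero idempotent below E; its preimage lies below e_x and so is
    equal to e_x. *)
Lemma aut_point x : exists y u v,
  [/\ u * v = 1, v * u = 1 & Psi (e x) = v * e y * u].
Proof.
have [Theta autT [PT TP]] := aut_inverse.
have TM a b : Theta (a * b) = Theta a * Theta b by have [_ _ m _] := autT.
have EE : Psi (e x) * Psi (e x) = Psi (e x) by rewrite -autM point_idem.
have [u [v [uv vu]]] := idempotent_conj EE; set E := Psi (e x) in EE *.
set Ed := diag _ => uE.
have vEd : v * Ed = E * v.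
  by rewrite -[LHS]mulr1 -uv !mulrA -(mulrA v) -uE !mulrA vu mul1r.
have [y Ey] : exists y, E.1 y y = 1.
  apply: contrapT => N1; case: (@point_neq0 _ X K x); apply: aut_inj.
  rewrite -/E aut0 -[E]mul1r -vu -mulrA uE.
  suff -> : Ed = 0 by rewrite mul0r mulr0.
  apply: idealizationP => z t //=.
  case: (idempotent_diagonal z EE) => [->|?]; first by rewrite mul0r.
  by case: N1; exists z.
have eEd : e y * Ed = e y.
  rewrite diag_mul; apply: idealizationP => z t //=.
  by have [->|_] := eqVneq z y; rewrite ?Ey ?mul0r ?mulr1.
have Ede : Ed * e y = e y.
  rewrite diag_mul; apply: idealizationP => z t //=.
  by have [->|_] := eqVneq z y; rewrite ?Ey ?mul0r ?mulr1 ?mulr0 ?mul0r.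
exists y, u, v; split=> //; set F := v * e y * u.
have FF : F * F = F.
  by rewrite /F !mulrA -(mulrA _ u v) uv mulr1 -(mulrA v) point_idem.
have EF : E * F = F by rewrite /F !mulrA -vEd -(mulrA v) Ede.
have FE : F * E = F by rewrite /F -!mulrA uE (mulrA (e y)) eEd.
have [] := @point_local _ _ _ (Theta F) x.
- by rewrite -TM FF.
- by rewrite -[e x]PT -TM EF.
- by rewrite -[e x]PT -TM FE.
- move=> F0; have : F = 0 by rewrite -[F]TP F0 aut0.
  move=> F0'; case: (@point_neq0 _ X K y).
  rewrite -[e y]mul1r -uv -[u * v * _]mulr1 -uv.
  by rewrite !mulrA -(mulrA u v) -(mulrA u (v * _)) -/F F0' mulr0 mul0r.
- by move=> Fe; rewrite -[F]TP Fe.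
Qed.

Lemma conj_point_diagonal u v y z : v * u = 1 ->
  (v * e y * u).1 z z = (z == y)%:R.
Proof.
move=> vu; rewrite mul_diagonal mul_point1 mulrAC -mul_diagonal vu /= eqxx.
by rewrite mul1r.
Qed.

End Automorphism.

Section InducedMap.
Variables (d : Order.disp_t) (X : porderType d) (K : fieldType).
Local Notation D := (idealization X K).
Local Notation e := (@point_idempotent _ X K).

Lemma induced_map (Psi : D -> D) : algebra_automorphism Psi ->
  exists s : X -> X, forall x, exists u v,
    [/\ u * v = 1, v * u = 1 & Psi (e x) = v * e (s x) * u].
Proof. by move=> aP; have [s Hs] := @choice _ _ _ (aut_point aP); exists s. Qed.

Lemma induced_cancel (Psi Theta : D -> D) s t :
  algebra_automorphism Psi -> cancel Theta Psi ->
  (forall x, exists u v,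
    [/\ u * v = 1, v * u = 1 & Psi (e x) = v * e (s x) * u]) ->
  (forall x, exists u v,
    [/\ u * v = 1, v * u = 1 & Theta (e x) = v * e (t x) * u]) ->
  cancel t s.
Proof.
move=> aP TP Hs Ht y; have [u [v [uv vu Ey]]] := Ht y.
have [u' [v' [uv' vu' Ety]]] := Hs (t y).
have Ey' : e y = (Psi v * v') * e (s (t y)) * (u' * Psi u).
  by rewrite -[LHS]TP Ey !(autM aP) Ety !mulrA.
have inv : (Psi v * v') * (u' * Psi u) = 1.
  by rewrite mulrA -(mulrA _ v') vu' mulr1 -(autM aP) vu (aut1 aP).
have := point_diagonal K y y; rewrite Ey' conj_point_diagonal // eqxx.
have [//|_ /eqP] := eqVneq y (s (t y)).
by rewrite eq_sym oner_eq0.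
Qed.

(** Up to multiplication by units, Psi sends e_x D e_y into e_(s x) D e_(s y),
    which is zero if s x <= s y fails. *)
Lemma induced_homo (Psi : D -> D) s x y : algebra_automorphism Psi ->
  (forall x, exists u v,
    [/\ u * v = 1, v * u = 1 & Psi (e x) = v * e (s x) * u]) ->
  (x <= y)%O -> (s x <= s y)%O.
Proof.
move=> aP Hs xy; apply: contrapT => /negP nsxy.
have [u [v [_ _ Ex]]] := Hs x; have [u' [v' [_ _ Ey]]] := Hs y.
(* The witness that e_x D e_y is nonzero: the corner of the zeta function. *)
have zetaP : (fun x y => (x <= y)%O%:R : K) \in @incidence_pred _ X K.
  by apply/incidence_predP => z t /negPf ->.
pose m : D := e x * (0, Incidence zetaP) * e y.
have m0 : m = 0.
  apply: (aut_inj aP); rewrite (aut0 aP) !(autM aP) Ex Ey.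
  set c := Psi _; rewrite !mulrA.
  have -> : v * e (s x) * u * c * v' * e (s y) * u' =
     v * (e (s x) * (u * c * v') * e (s y)) * u' by rewrite !mulrA.
  suff -> : e (s x) * (u * c * v') * e (s y) = 0 by rewrite mulr0 mul0r.
  have corner0 i z t : (z == s x)%:R * incidence_fun i z t * (t == s y)%:R = 0 :> K.
    have [->|_] := eqVneq z (s x); last by rewrite !mul0r.
    have [->|_] := eqVneq t (s y); last by rewrite mulr0.
    by rewrite (incidence_eq0 i nsxy) mulr0 mul0r.
  apply: idealizationP => z t.
    by rewrite mul_point1 point_mul1 corner0.
  by rewrite mul_point2 point_mul2 corner0.
have := congr1 (fun a : D => a.2 x y) m0.
rewrite mul_point2 point_mul2 !eqxx mul1r mulr1 /= xy.
by apply/eqP/oner_neq0.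
Qed.

Lemma induced_poset_automorphism (Psi : D -> D) : algebra_automorphism Psi ->
  exists alpha : poset_automorphism X, forall x z,
    (Psi (e x)).1 z z = (z == alpha x)%:R.
Proof.
move=> aP; have [Theta aT [PT TP]] := aut_inverse aP.
have [s Hs] := induced_map aP; have [t Ht] := induced_map aT.
have ts := induced_cancel aP TP Hs Ht; have st := induced_cancel aT PT Ht Hs.
have mono : {mono s : x y / (x <= y)%O}.
  move=> x y; apply/idP/idP; last exact: (induced_homo aP Hs).
  by move/(induced_homo aT Ht); rewrite !st.
exists (PosetAutomorphism st ts mono) => x z /=.
by have [u [v [_ vu ->]]] := Hs x; rewrite conj_point_diagonal.
Qed.

End InducedMap.

(** * Conjugating the images of the e_x back to the e_x *)

Section Straightening.
Variables (d : Order.disp_t) (X : porderType d) (K : fieldType).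
Local Notation D := (idealization X K).
Local Notation FI := (finitary X K).
Local Notation e := (@point_idempotent _ X K).
Variable Psi : D -> D.
Hypothesis autPsi : algebra_automorphism Psi.
Hypothesis diagPsi : forall x z, (Psi (e x)).1 z z = (z == x)%:R.
Local Notation E := (fun x => (Psi (e x)).1).

Section Indicator.
Variable Y : set X.

(** The first component of Psi(e_Y), e_Y being the diagonal indicator of Y. *)
Definition indicator_image : FI := (Psi (diag (fun z => `[< Y z >]%:R))).1.
Local Notation EY := indicator_image.

Lemma image_point_indicator x : E x * EY = `[< Y x >]%:R *: E x.
Proof.
rewrite -[LHS]/((Psi (e x) * Psi (diag _)).1) -(autM autPsi) diag_mul.
rewrite -[RHS]/((_ *: Psi (e x)).1) -(autZ autPsi); congr (Psi _).1.
apply: idealizationP => z t /=; last by rewrite mulr0.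
have [->|_] := eqVneq z x; last by rewrite !mul0r mulr0.
by rewrite !mul1r.
Qed.

Lemma indicator_diagonal x : EY x x = `[< Y x >]%:R.
Proof.
have := congr1 (fun f : FI => f x x) (image_point_indicator x).
rewrite -[(E x * EY) x x]/(conv (E x) EY x x) conv_diagonal.
rewrite -[(_ *: E x) x x]/(`[< Y x >]%:R * E x x x).
by rewrite diagPsi eqxx mul1r mulr1.
Qed.

(** If p is in Y, q is not, and the row of Psi(e_p) vanishes strictly between
    p and q, then the entry at (p, q) of Psi(e_Y) is that of
    Psi(e_p): it is read off from Psi(e_p) Psi(e_Y) = Psi(e_p), where only the
    terms at p and q survive. *)
Lemma indicator_first_entry p q : (p < q)%O ->
  (forall z, (p < z)%O -> (z < q)%O -> E p p z = 0) -> Y p -> ~ Y q ->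
  EY p q = E p p q.
Proof.
move=> pq gap Yp Yq.
have := congr1 (fun f : FI => f p q) (image_point_indicator p).
rewrite asboolT // scale1r => <-.
rewrite -[RHS]/(conv (E p) EY p q) (@convolution_seq _ _ _ _ _ [:: p; q]) /=.
- rewrite big_cons big_seq1 indicator_diagonal asboolF // mulr0 addr0.
  by rewrite diagPsi eqxx mul1r.
- by rewrite inE andbT (lt_eqF pq).
move=> z pz zq nz; rewrite !inE; apply: contraNT nz; rewrite negb_or.
move=> /andP[zp zq']; rewrite gap ?mul0r //.
  by rewrite lt_neqAle eq_sym zp.
by rewrite lt_neqAle zq'.
Qed.

End Indicator.

Lemma rows_incidence_subproof : (fun p q => E p p q) \in @incidence_pred _ X K.
Proof. by apply/incidence_predP => p q; apply: incidence_eq0. Qed.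

(** The function whose row at p is the row at p of Psi(e_p) is finitary. *)
Lemma rows_finitary_subproof :
  Incidence rows_incidence_subproof \in @finitary_pred _ X K.
Proof.
apply/finitary_predP => x y xy.
pose P := [set p | exists q,
  [/\ (x <= p)%O, (p < q)%O, (q <= y)%O & E p p q != 0]]%classic.
have [finP|infP] := pselect (finite_set P).
  apply: (@sub_finite_set _ _
    (\bigcup_(p in P) nonzero_subintervals (E p) x y)%classic).
    move=> [p q] [/= xp pq qy nz].
    by exists p; [exists q|split].
  by apply: bigcup_finite => // p _; apply: finitary_finite.
(* P is the infinite set of starting points of nonzero entries in [x, y]; for p
   in P, let q p be a minimal endpoint. *)
have /choice[q Hq] : forall p, exists q, P p ->
    [/\ (p < q)%O, (q <= y)%O, E p p q != 0 &
      forall z, (p < z)%O -> (z < q)%O -> E p p z = 0].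
  move=> p; have [Pp|] := pselect (P p); last by exists p.
  have [q0 [xp pq0 q0y nz0]] := Pp.
  pose A := [set q | nonzero_subintervals (E p) x y (p, q)]%classic.
  have [||q [_ /= pq qy nz] minq] := @finite_minimal _ X A.
  - apply: (@sub_finite_set _ _
      ((fun t => t.2) @` nonzero_subintervals (E p) x y)%classic).
      by move=> q Aq; exists (p, q).
    by apply/finite_image/finitary_finite.
  - by exists q0.
  exists q => _; split=> // z pz zq; apply: contrapT => /eqP nzz.
  suff : ~~ (z < q)%O by rewrite zq.
  by apply: minq; split=> //=; apply: le_trans (ltW zq) qy.
have [||Y [YP infY indY]] := @infinite_independent_subset _ P q => //.
  by move=> p /Hq[pq _ _ _] qp; move: pq; rewrite qp ltxx.
case: infY; apply: (@sub_finite_set _ _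
  ((fun t => t.1) @` nonzero_subintervals (indicator_image Y) x y)%classic).
  move=> p Yp; have [pq qy nz gap] := Hq p (YP p Yp).
  have [q0 [xp _ _ _]] := YP p Yp.
  exists (p, q p) => //; split=> //=.
  by rewrite indicator_first_entry // => Yq; apply: (indY p (q p)).
by apply/finite_image/finitary_finite.
Qed.

Lemma rows_incidence2_subproof :
  (fun p q => (Psi (e p)).2 p q) \in @incidence_pred _ X K.
Proof. by apply/incidence_predP => p q; apply: incidence_eq0. Qed.

(** The formal sum of the products e_p Psi(e_p). *)
Definition rows : D :=
  (Finitary rows_finitary_subproof, Incidence rows_incidence2_subproof).

Lemma point_mul_rows p : e p * rows = e p * Psi (e p).
Proof.
apply: idealizationP => z t; rewrite !pointE /=.
  by have [->|_] := eqVneq z p; rewrite ?mul0r.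
by have [->|_] := eqVneq z p; rewrite ?mul0r.
Qed.

Lemma point_mulP (a b : D) : (forall p, e p * a = e p * b) -> a = b.
Proof.
move=> eab; apply: idealizationP => x y.
  have := congr1 (fun c : D => c.1 x y) (eab x).
  by rewrite !pointE eqxx !mul1r.
have := congr1 (fun c : D => c.2 x y) (eab x).
by rewrite !pointE eqxx !mul1r.
Qed.

Lemma rows_mul x : rows * Psi (e x) = e x * rows.
Proof.
apply: point_mulP => p; rewrite !mulrA point_mul_rows -mulrA -(autM autPsi).
rewrite !point_mul_point (autZ autPsi).
have [->|_] := eqVneq p x; first by rewrite !scale1r point_mul_rows.
by rewrite !scale0r mulr0 mul0r.
Qed.

Lemma straighten_points : exists u v : D,
  [/\ u * v = 1, v * u = 1 & forall x, u * Psi (e x) * v = e x].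
Proof.
have [|v [uv vu]] := @idealization_invertible _ X K rows.
  by move=> x; rewrite /= diagPsi eqxx.
by exists rows, v; split=> // x; rewrite rows_mul -mulrA uv mulr1.
Qed.

End Straightening.

(** * Matrix units *)

Section MatrixUnits.
Variables (d : Order.disp_t) (X : porderType d) (K : fieldType).
Local Notation I := (incidence X K).
Local Notation FI := (finitary X K).
Local Notation D := (idealization X K).
Local Notation e := (@point_idempotent _ X K).
Implicit Types (x y z : X).

Lemma unit_incidence_subproof x y :
  (fun u v => ((u == x) && (v == y) && (x <= y)%O)%:R) \in @incidence_pred _ X K.
Proof.
apply/incidence_predP => u v; have [->|//] := eqVneq u x.
by have [->|//] := eqVneq v y; move=> /negPf ->.
Qed.

(** The function equal to 1 at (x, y) and 0 elsewhere; it is 0 if x <= y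
    fails. *)
Definition incidence_unit x y : I := Incidence (unit_incidence_subproof x y).

Lemma unit_finitary_subproof x y : incidence_unit x y \in @finitary_pred _ X K.
Proof.
apply/finitary_predP => u v _.
apply: (@sub_finite_set _ _ [set (x, y)]%classic); last exact: finite_set1.
move=> [s t] [_ _ _] /=; have [->|] := eqVneq s x; last by rewrite eqxx.
by have [->//|] := eqVneq t y; rewrite eqxx.
Qed.

Definition finitary_unit x y : FI := Finitary (unit_finitary_subproof x y).

(** The two matrix units of D(X,K) at (x, y): [munit] in the FI(X,K) component
    and [eunit] in the I(X,K) component. *)
Definition munit x y : D := (finitary_unit x y, 0).
Definition eunit x y : D := (0, incidence_unit x y).

Lemma conv_unitl x y i u v : (x <= y)%O ->
  conv (incidence_unit x y) i u v = (u == x)%:R * i y v.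
Proof.
move=> xy; have [uv|uv] := boolP (u <= v)%O; last first.
  rewrite incidence_eq0 //; have [E|_] := eqVneq u x; last by rewrite mul0r.
  rewrite incidence_eq0 ?mulr0 //.
  by apply: contra uv => yv; rewrite E (le_trans xy yv).
rewrite (@convolution_seq _ _ _ _ _ [:: y]) //.
  by rewrite big_seq1 /= eqxx xy !andbT.
move=> z _ _ /=; rewrite inE; have [//|_] := eqVneq z y.
by rewrite andbF mul0r eqxx.
Qed.

Lemma conv_unitr x y i u v : (x <= y)%O ->
  conv i (incidence_unit x y) u v = i u x * (v == y)%:R.
Proof.
move=> xy; rewrite (@convolution_seq _ _ _ _ _ [:: x]) //.
  by rewrite big_seq1 /= eqxx xy !andbT.
move=> z _ _ /=; rewrite inE; have [//|_] := eqVneq z x.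
by rewrite mulr0 eqxx.
Qed.

Lemma munit_mul1 x y (a : D) u v : (x <= y)%O ->
  (munit x y * a).1 u v = (u == x)%:R * a.1 y v.
Proof. exact: conv_unitl. Qed.
Lemma munit_mul2 x y (a : D) u v : (x <= y)%O ->
  (munit x y * a).2 u v = (u == x)%:R * a.2 y v.
Proof. by move=> xy; rewrite idealization_mul2E conv0l addr0 conv_unitl. Qed.
Lemma mul_munit1 x y (a : D) u v : (x <= y)%O ->
  (a * munit x y).1 u v = a.1 u x * (v == y)%:R.
Proof. exact: conv_unitr. Qed.
Lemma mul_munit2 x y (a : D) u v : (x <= y)%O ->
  (a * munit x y).2 u v = a.2 u x * (v == y)%:R.
Proof. by move=> xy; rewrite idealization_mul2E conv0r add0r conv_unitr. Qed.

Lemma munit_munit x y z : (x <= y)%O -> (y <= z)%O ->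
  munit x y * munit y z = munit x z.
Proof.
move=> xy yz; have xz := le_trans xy yz; apply: idealizationP => u v.
  rewrite munit_mul1 //= eqxx xz yz !andbT.
  by case: (u == x); rewrite ?mul1r ?mul0r.
by rewrite munit_mul2 //= mulr0.
Qed.

Lemma eunit_munit x y z : (x <= y)%O -> (y <= z)%O ->
  eunit x y * munit y z = eunit x z.
Proof.
move=> xy yz; have xz := le_trans xy yz; apply: idealizationP => u v.
  by rewrite mul_munit1 //= mul0r.
by rewrite mul_munit2 //= eqxx xz xy !andbT; case: (u == x); case: (v == z);
  rewrite ?mul1r ?mulr1 ?mul0r.
Qed.

Lemma munit_eunit x y z : (x <= y)%O -> (y <= z)%O ->
  munit x y * eunit y z = eunit x z.
Proof.
move=> xy yz; have xz := le_trans xy yz; apply: idealizationP => u v.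
  by rewrite munit_mul1 //= mulr0.
by rewrite munit_mul2 //= eqxx xz yz !andbT; case: (u == x); case: (v == z);
  rewrite ?mul1r ?mulr1 ?mul0r.
Qed.

Lemma eunit_eunit x y z t : eunit x y * eunit z t = 0.
Proof.
apply: idealizationP => u v; first by rewrite idealization_mul1E mul0r.
by rewrite idealization_mul2E conv0l_l conv0r_r addr0.
Qed.

Lemma munit_diagonal x : munit x x = e x.
Proof.
apply: idealizationP => u v //=; rewrite lexx andbT.
have [->|_] := eqVneq u x; last by rewrite mul0r.
by rewrite mul1r eq_sym.
Qed.

Lemma corner_decomposition x y (a : D) :
  e x * a * e y = a.1 x y *: munit x y + a.2 x y *: eunit x y.
Proof.
have H (i : I) u v : (u == x)%:R * i u v * (v == y)%:R =
    i x y * incidence_unit x y u v.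
  rewrite /=; have [->|_] := eqVneq u x; last by rewrite !mul0r mulr0.
  have [->|_] := eqVneq v y; last by rewrite !mulr0.
  rewrite mul1r; have [//|xy] := boolP (x <= y)%O.
  by rewrite incidence_eq0 // !mul0r.
apply: idealizationP => u v.
  rewrite mul_point1 point_mul1 H.
  rewrite -[RHS]/(a.1 x y * incidence_unit x y u v + a.2 x y * 0).
  by rewrite mulr0 addr0.
rewrite mul_point2 point_mul2 H.
rewrite -[RHS]/(a.1 x y * 0 + a.2 x y * incidence_unit x y u v).
by rewrite mulr0 add0r.
Qed.

Lemma eunit2_entry x y : (x <= y)%O -> (eunit x y).2 x y = 1.
Proof. by move=> xy /=; rewrite !eqxx xy. Qed.

End MatrixUnits.

(** * Automorphisms fixing every e_x *)

Section Normalized.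
Variables (d : Order.disp_t) (X : porderType d) (K : fieldType).
Local Notation I := (incidence X K).
Local Notation FI := (finitary X K).
Local Notation D := (idealization X K).
Local Notation e := (@point_idempotent _ X K).
Local Notation m := (@munit _ X K).
Local Notation ep := (@eunit _ X K).
Implicit Types (x y z : X).
Variable Psi : D -> D.
Hypothesis autPsi : algebra_automorphism Psi.
Hypothesis fixPsi : forall x, Psi (e x) = e x.

(* The matrix of Psi on the corner e_x D e_y, in the basis m x y, ep x y. *)
Local Notation A x y := ((Psi (m x y)).1 x y).
Local Notation B x y := ((Psi (m x y)).2 x y).
Local Notation C x y := ((Psi (ep x y)).1 x y).
Local Notation G x y := ((Psi (ep x y)).2 x y).

Lemma normalized_entries (a : D) x y :
  (Psi a).1 x y = a.1 x y * A x y + a.2 x y * C x y /\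
  (Psi a).2 x y = a.1 x y * B x y + a.2 x y * G x y.
Proof.
have E : e x * Psi a * e y = a.1 x y *: Psi (m x y) + a.2 x y *: Psi (ep x y).
  rewrite -(fixPsi x) -(fixPsi y) -!(autM autPsi) corner_decomposition.
  by rewrite (autD autPsi) !(autZ autPsi).
split.
  have := congr1 (fun b : D => b.1 x y) E.
  by rewrite mul_point1 point_mul1 !eqxx mul1r mulr1.
have := congr1 (fun b : D => b.2 x y) E.
by rewrite mul_point2 point_mul2 !eqxx mul1r mulr1.
Qed.

Lemma normalized_munit x y : (x <= y)%O ->
  Psi (m x y) = A x y *: m x y + B x y *: ep x y.
Proof.
move=> xy; rewrite -corner_decomposition -{1}(fixPsi x) -(fixPsi y) -!(autM autPsi).
by rewrite -!munit_diagonal !munit_munit.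
Qed.

Lemma normalized_eunit x y : (x <= y)%O ->
  Psi (ep x y) = C x y *: m x y + G x y *: ep x y.
Proof.
move=> xy; rewrite -corner_decomposition -{1}(fixPsi x) -(fixPsi y) -!(autM autPsi).
by rewrite -!munit_diagonal munit_eunit // eunit_munit.
Qed.

(** C x x = 0 because the square of ep x x is 0. *)
Lemma normalized_eunit_point x : Psi (ep x x) = G x x *: ep x x.
Proof.
suff C0 : C x x = 0 by rewrite {1}normalized_eunit // C0 scale0r add0r.
have := congr1 (fun b : D => b.1 x x) (autM autPsi (ep x x) (ep x x)).
rewrite eunit_eunit (aut0 autPsi) mul_diagonal => /esym/eqP.
by rewrite mulf_eq0 orbb => /eqP.
Qed.

(** Evaluating Psi on ep x y = ep x x * m x y, and below on m x y * ep y y,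
    shows that the diagonal entries G x x and G y y agree when x <= y. *)
Lemma eunit_left x y : (x <= y)%O -> Psi (ep x y) = (G x x * A x y) *: ep x y.
Proof.
move=> xy; set g := G x x; set a := A x y.
rewrite -(eunit_munit K (lexx x) xy) (autM autPsi).
rewrite normalized_eunit_point normalized_munit // mulrDr.
rewrite -!idealization_scalerAr -!idealization_scalerAl eunit_eunit !scaler0 addr0.
by rewrite eunit_munit // scalerA mulrC.
Qed.

Lemma eunit_right x y : (x <= y)%O -> Psi (ep x y) = (A x y * G y y) *: ep x y.
Proof.
move=> xy; set g := G y y; set a := A x y.
rewrite -(munit_eunit K xy (lexx y)) (autM autPsi).
rewrite normalized_eunit_point normalized_munit // mulrDl.
rewrite -!idealization_scalerAr -!idealization_scalerAl eunit_eunit !scaler0 addr0.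
by rewrite munit_eunit // !scalerA mulrC.
Qed.

Lemma eunit_image_neq0 x y : (x <= y)%O -> Psi (ep x y) <> 0.
Proof.
move=> xy; rewrite -(aut0 autPsi) => /(aut_inj autPsi) E.
have := congr1 (fun b : D => b.2 x y) E; rewrite eunit2_entry //.
by apply/eqP/oner_neq0.
Qed.

Lemma normalized_entry_neq0 x y : (x <= y)%O -> A x y != 0.
Proof.
move=> xy; apply/eqP => A0; apply: (eunit_image_neq0 xy).
by rewrite eunit_left // A0 mulr0 scale0r.
Qed.

Lemma normalized_entry_mul x y z : (x <= y)%O -> (y <= z)%O ->
  A x y * A y z = A x z.
Proof.
move=> xy yz; rewrite -(munit_munit K xy yz) (autM autPsi).
have := normalized_munit xy; set p := A x y; set q := B x y => ->.
rewrite mulrDl -!idealization_scalerAl.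
rewrite -[RHS]/(p * (m x y * Psi (m y z)).1 x z + q * (ep x y * Psi (m y z)).1 x z).
by rewrite munit_mul1 // eqxx mul1r idealization_mul1E mul0r mulr0 addr0.
Qed.

Lemma normalized_scalar : connected_poset X ->
  exists2 k, k != 0 & forall x y, (x <= y)%O -> C x y = 0 /\ G x y = k * A x y.
Proof.
move=> conn.
have Gle x y : (x <= y)%O -> G x x = G y y.
  move=> xy; apply: (mulfI (normalized_entry_neq0 xy)).
  have := congr1 (fun b : D => b.2 x y) (eunit_left xy); rewrite eunit_right //=.
  by rewrite !eqxx xy !mulr1 => ->; rewrite mulrC.
have Gconst x y : G x x = G y y.
  have [s [ps <-]] := conn x y; elim: s x ps => //= z s IH x /andP[xz ps].
  by rewrite -(IH z ps); case/orP: xz => /Gle.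
(* If X is empty the condition on k is vacuous, and k = 1 will do. *)
have [k k0 Gk] : exists2 k, k != 0 & forall x, G x x = k.
  have [[x _]|none] := pselect (exists x : X, True); last first.
    by exists 1; [exact: oner_neq0|move=> x; case: none; exists x].
  exists (G x x); last by move=> y.
  apply/eqP => G0; apply: (eunit_image_neq0 (lexx x)).
  by rewrite normalized_eunit_point G0 scale0r.
exists k => // x y xy; have E := eunit_left xy.
split; first by rewrite E /= mulr0.
by rewrite E /= !eqxx xy mulr1 Gk.
Qed.

Lemma normalized_sigma_subproof : (fun x y => A x y) \in @incidence_pred _ X K.
Proof. by apply/incidence_predP => x y; apply: incidence_eq0. Qed.

(** The multiplicative element sigma attached to Psi. *)
Definition normalized_sigma : I := Incidence normalized_sigma_subproof.

Lemma normalized_sigma_multiplicative : is_multiplicative normalized_sigma.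
Proof.
by split; [exact: normalized_entry_neq0|exact: normalized_entry_mul].
Qed.

Lemma normalized_first (a : D) : connected_poset X ->
  (Psi a).1 = multiplicative_map normalized_sigma a.1.
Proof.
move=> conn; have [k _ H] := normalized_scalar conn.
apply: finitaryP => x y; rewrite (normalized_entries a x y).1 /=.
have [xy|xy] := boolP (x <= y)%O; last by rewrite !incidence_eq0 // !mul0r addr0.
by rewrite (H x y xy).1 mulr0 addr0 mulrC.
Qed.

End Normalized.

(** * Decomposition of the automorphisms of D(X,K) *)

Section Decomposition.
Variables (d : Order.disp_t) (X : porderType d) (K : fieldType).
Local Notation I := (incidence X K).
Local Notation FI := (finitary X K).
Local Notation D := (idealization X K).
Local Notation e := (@point_idempotent _ X K).
Implicit Types (f g u v : FI) (i j : I) (x y z : X) (a b : D).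

(** If conjugation by u fixes every e_x then u commutes with them, so that it is
    diagonal. *)
Lemma fix_points_diagonal u v : v * u = 1 ->
  (forall x, u * (e x).1 * v = (e x).1) -> u = finitary_diagonal (fun x => u x x).
Proof.
move=> vu H; have comm x : u * (e x).1 = (e x).1 * u.
  by rewrite -{2}(H x) -mulrA vu mulr1.
apply: finitaryP => x y /=.
have := congr1 (fun f : FI => f x y) (comm x).
rewrite mul_diagonalr mul_diagonall eqxx mul1r => <-.
by have [->|_] := eqVneq x y; rewrite ?mulr0.
Qed.

Lemma multiplicative_diagonal (sigma : I) x :
  is_multiplicative sigma -> sigma x x = 1.
Proof.
move=> [nz m]; apply: (mulfI (nz x x (lexx x))).
by rewrite m // mulr1.
Qed.

(** If M_sigma is conjugation by u on FI(X,K), then u is diagonal, and pointwise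
    multiplication by sigma is conjugation by u on I(X,K) too. *)
Lemma multiplicative_inner_incidence (sigma : I) u v :
  is_multiplicative sigma -> u * v = 1 -> v * u = 1 ->
  (forall f, multiplicative_map sigma f = u * f * v) ->
  forall i, conv v (conv (Incidence (pointwise_incidence sigma i)) u) = i.
Proof.
move=> ms uv vu H i.
have fixu x : u * (e x).1 * v = (e x).1.
  rewrite -H; apply: finitaryP => y z /=.
  have [->|_] := eqVneq y z; last by rewrite !mulr0.
  by rewrite multiplicative_diagonal ?mul1r.
have fixv x : v * (e x).1 * u = (e x).1.
  by rewrite -{1}(fixu x) !mulrA vu mul1r -mulrA vu mulr1.
have ud := fix_points_diagonal vu fixu; have vd := fix_points_diagonal uv fixv.
have vux x : v x x * u x x = 1.
  by rewrite -[LHS](conv_diagonal v u) -[conv v u]/(finitary_incidence (v * u)) vu /= eqxx.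
have sE x y : (x <= y)%O -> sigma x y = u x x * v y y.
  move=> xy; have -> : sigma x y = (u * finitary_unit K x y * v) x y.
    by rewrite -H /= !eqxx xy mulr1.
  rewrite {1}ud {1}vd mul_diagonalr mul_diagonall /= !eqxx xy.
  by rewrite mulr1.
apply: incidenceP => x y; rewrite vd ud conv_diagonall conv_diagonalr /=.
have [xy|xy] := boolP (x <= y)%O; last by rewrite (incidence_eq0 i) // !(mulr0, mul0r).
rewrite sE // mulrA mulrA mulrA vux mul1r.
by rewrite mulrAC vux mul1r.
Qed.

(** Conjugation by (1, -j) adds to the second component an inner derivation of
    the first. *)
Lemma conj_unipotent f i j :
  ((1, - j) : D) * ((f, i) : D) * ((1, j) : D) =
  (f, conv f j - conv j f + i) :> D.
Proof.
apply: idealizationP => x y; first by rewrite !idealization_mul1E mul1r mulr1.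
rewrite !idealization_mul2E idealization_mul1E mul1r.
rewrite -[(- j)]scaleN1r !conv1l !conv1r convZlr scaleN1r.
by rewrite -addrA [i - _]addrC.
Qed.

Hypothesis connX : connected_poset X.
Hypothesis mult_inner : forall sigma : I, is_multiplicative sigma ->
  inner_automorphism (multiplicative_map sigma).
Hypothesis der_inner : forall Der : FI -> I,
  is_derivation Der -> is_inner_derivation Der.

Lemma normalized_inner (Psi : D -> D) : algebra_automorphism Psi ->
  (forall x, Psi (e x) = e x) ->
  exists k (U V : D), [/\ k != 0, U * V = 1, V * U = 1 &
    forall a, Psi a = U * tilde_scale k a * V].
Proof.
move=> aP fixP; have [k k0 kH] := normalized_scalar aP fixP connX.
have ms := normalized_sigma_multiplicative aP fixP.
have [u [v [uv vu H]]] := mult_inner ms.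
set sigma := normalized_sigma Psi in ms H.
pose W : D := (u, 0); pose V : D := (v, 0).
have WV : W * V = 1 by congr pair; rewrite /= ?conv0l ?conv0r ?addr0.
have VW : V * W = 1 by congr pair; rewrite /= ?conv0l ?conv0r ?addr0.
(* Q acts as the identity on FI(X,K) modulo I(X,K), and as k on I(X,K). *)
pose Q a := V * Psi a * W.
have aQ : algebra_automorphism Q.
  have aI : algebra_automorphism (fun a : D => V * a * W).
    by apply: inner_automorphismW; exists V, W.
  exact: (algebra_automorphism_comp aI aP).
have Q1 a : (Q a).1 = a.1.
  rewrite -[LHS]/(v * (Psi a).1 * u) (normalized_first aP) // H.
  by rewrite !mulrA vu mul1r -mulrA vu mulr1.
have Q2 i : (Q (0, i)).2 = k *: i.
  rewrite -[LHS]/(conv (v * (Psi (0, i)).1) 0 +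
    conv (conv v (Psi (0, i)).2 + conv 0 (Psi (0, i)).1) u).
  rewrite conv0r add0r conv0l addr0.
  have -> : (Psi (0, i)).2 = Incidence (pointwise_incidence sigma (k *: i)).
    apply: incidenceP => x y; rewrite (normalized_entries aP fixP _ x y).2 /= mul0r add0r.
    have [xy|xy] := boolP (x <= y)%O; last first.
      by rewrite !(incidence_eq0 _ xy) !mul0r.
    by rewrite (kH x y xy).2 mulrA mulrC [i x y * k]mulrC.
  by rewrite -convA_lr (multiplicative_inner_incidence ms uv vu H).
pose Der f : I := (Q (f, 0)).2.
have QD i f : Q (f, i) = Q (f, 0) + Q (0, i).
  by rewrite -(autD aQ); congr (Q _); congr pair; rewrite /= ?addr0 ?add0r.
have dD : is_derivation Der.
  split.
    move=> c f g; rewrite /Der.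
    have -> : ((c *: f + g, 0) : D) = c *: ((f, 0) : D) + (g, 0).
      by congr pair; rewrite /= ?scaler0 ?addr0.
    by rewrite (autD aQ) (autZ aQ).
  move=> f g; rewrite /Der.
  have -> : ((f * g, 0) : D) = ((f, 0) : D) * (g, 0).
    by congr pair; rewrite /= conv0l conv0r addr0.
  by rewrite (autM aQ) idealization_mul2E !Q1 addrC.
have [j Hj] := der_inner dD.
pose T : D := (1, - j); pose T' : D := (1, j).
have TT' : T * T' = 1.
  by congr pair; rewrite /= ?mulr1 // conv1l conv1r subrr.
have T'T : T' * T = 1.
  by congr pair; rewrite /= ?mulr1 // conv1l conv1r addNr.
have QE a : Q a = T * tilde_scale k a * T'.
  case: a => f i; rewrite QD /T /T' conj_unipotent -Hj -(Q2 i) /Der.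
  rewrite [Q (f, 0)]surjective_pairing [Q (0, i)]surjective_pairing !Q1.
  by congr pair; rewrite /= addr0.
exists k, (W * T), (T' * V); split=> //.
- by rewrite !mulrA -(mulrA W) TT' mulr1.
- by rewrite !mulrA -(mulrA T') VW mulr1.
- move=> a; have -> : Psi a = W * Q a * V.
    by rewrite /Q !mulrA WV mul1r -mulrA WV mulr1.
  by rewrite QE !mulrA.
Qed.

Lemma tilde_aut_point (alpha : poset_automorphism X) (a : D) z :
  (tilde_aut (poset_automorphism_inverse alpha) a).1 z z = a.1 (alpha z) (alpha z).
Proof. by []. Qed.

Lemma automorphism_decomposition (Psi : D -> D) : algebra_automorphism Psi ->
  exists (alpha : poset_automorphism X) (k : K) (U V : D),
    [/\ k != 0, U * V = 1, V * U = 1 &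
    forall a, Psi a = U * tilde_aut alpha (tilde_scale k a) * V].
Proof.
move=> aP; have [alpha Halpha] := induced_poset_automorphism aP.
pose beta := poset_automorphism_inverse alpha.
pose Psi0 := tilde_aut beta \o Psi.
have aP0 : algebra_automorphism Psi0.
  exact: algebra_automorphism_comp (tilde_aut_automorphism _ _) aP.
have dP0 x z : (Psi0 (e x)).1 z z = (z == x)%:R.
  rewrite /Psi0 [LHS]tilde_aut_point Halpha.
  by rewrite (can_eq (pa_funK alpha)).
have [u [v [uv vu H]]] := straighten_points aP0 dP0.
have aI : algebra_automorphism (fun a : D => u * a * v).
  by apply: inner_automorphismW; exists u, v.
have [||k [U [V [k0 UV VU HP]]]] :=
  @normalized_inner ((fun a : D => u * a * v) \o Psi0) => //.
  exact: algebra_automorphism_comp.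
have [_ A1 AM _] := tilde_aut_automorphism K alpha.
exists alpha, k, (tilde_aut alpha (v * U)), (tilde_aut alpha (V * u)).
split=> //.
- by rewrite -AM !mulrA -(mulrA v) UV mulr1 vu A1.
- by rewrite -AM !mulrA -(mulrA V) uv mulr1 VU A1.
move=> a; rewrite -!AM -[LHS](tilde_autVK alpha); congr (tilde_aut alpha _).
rewrite -[LHS]/(Psi0 a).
have -> : Psi0 a = v * (u * Psi0 a * v) * u.
  by rewrite !mulrA vu mul1r -mulrA vu mulr1.
have := HP a; rewrite /= => ->.
by rewrite !mulrA.
Qed.

End Decomposition.


Theorem theorem6p19 (K : fieldType) (d : Order.disp_t) (X : porderType d)
  (charK : 2%N \notin [pchar K])
  (connX : connected_poset X)
  (mult_inner : forall sigma : incidence X K, is_multiplicative sigma ->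
     inner_automorphism (multiplicative_map sigma))
  (der_inner : forall D : finitary X K -> incidence X K,
     is_derivation D -> is_inner_derivation D)
  (Phi1 Phi2 : idealization X K -> idealization X K)
  (invPhi1 : is_involution Phi1) (invPhi2 : is_involution Phi2) :
  equivalent_involutions Phi1 Phi2 <->
  exists (alpha : poset_automorphism X) (k : K),
    k != 0 /\
    inner_equivalent_involutions Phi1
      (tilde_aut alpha \o tilde_scale k \o Phi2 \o tilde_scale k^-1
         \o tilde_aut (poset_automorphism_inverse alpha)).
Proof.
split=> [[Psi [aP PsiPhi]]|[alpha [k [k0 [Psi [iP PsiPhi]]]]]].
  have [Theta aT [PT TP]] := aut_inverse aP.
  have [alpha [k [U [V [k0 UV VU HT]]]]] :=
    automorphism_decomposition connX mult_inner der_inner aT.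
  exists alpha, k; split=> //; exists (fun a => V * a * U).
  split; first by exists V, U.
  have E a : V * a * U = tilde_aut alpha (tilde_scale k (Psi a)).
    by rewrite -{1}(PT a) HT !mulrA VU mul1r -mulrA VU mulr1.
  move=> a /=; rewrite !E tilde_autK (tilde_scaleK k0).
  by rewrite -[Psi (Phi1 a)]/((Psi \o Phi1) a) PsiPhi.
pose beta := poset_automorphism_inverse alpha.
exists (tilde_scale k^-1 \o tilde_aut beta \o Psi); split.
  apply: algebra_automorphism_comp (inner_automorphismW iP).
  apply: algebra_automorphism_comp (tilde_aut_automorphism _ _).
  by apply: tilde_scale_automorphism; rewrite invr_eq0.
move=> a; rewrite /= -[Psi (Phi1 a)]/((Psi \o Phi1) a) PsiPhi /=.
by rewrite tilde_autK (tilde_scaleK k0).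
Qed.
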